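(* Let $n\ge 1$ be an integer, let $\Omega\subset\mathbb{R}^n$ be a domain, let $M\geq 1$, and let $f:\Omega\to\mathbb{R}^n$ be a continuous map such that for every rectifiable curve $\gamma$ in $\Omega$, $$M^{-1}\ell(\gamma)\leq \ell(f\circ\gamma)\leq M\,\ell(\gamma).$$ Then $f$ is locally Lipschitz, and $$M^{-1}|h|\leq |Df(x)h|\leq M|h|\qquad\text{for a.e. } x\in\Omega \text{ and for all } h\in\mathbb{R}^n.$$
   Context: A domain is a nonempty connected open set. A curve in $\Omega$ is a continuous map $\gamma:[a,b]\to\Omega$ from a compact interval; $\ell(\gamma)$ denotes its length (the supremum, over all partitions $a=t_0<\dots<t_k=b$, of $\sum_i|\gamma(t_i)-\gamma(t_{i-1})|$, possibly $+\infty$), and $\gamma$ is rectifiable if $\ell(\gamma)<\infty$. $|\cdot|$ is the Euclidean norm, ''a.e.'' refers to Lebesgue measure on $\mathbb{R}^n$, and $Df(x)$ is the (Fréchet) derivative of $f$ at $x$. A locally Lipschitz map is differentiable a.e. by Rademacher's theorem, so the last inequality is meaningful for a.e. $x$. *)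

(* Defs.v *)
From HB Require Import structures.
From mathcomp Require Import all_boot all_order all_algebra.
From mathcomp Require Import all_classical all_reals all_analysis.

Set Implicit Arguments.
Unset Strict Implicit.
Unset Printing Implicit Defensive.

Import Order.TTheory GRing.Theory Num.Theory.
Import numFieldNormedType.Exports.

Local Open Scope classical_set_scope.
Local Open Scope ring_scope.

(* R^n is 'rV[R]_n.  The library norm on 'rV[R]_n is the sup norm; it is used
   only through the notions of open set, continuity and differential, which are
   the same for the Euclidean norm.  All quantitative notions use [enorm]. *)
Definition enorm (R : realType) (n : nat) (x : 'rV[R]_n) : R :=
  Num.sqrt (\sum_(i < n) x ord0 i ^+ 2).

Definition domain (R : realType) (n : nat) (A : set 'rV[R]_n) : Prop :=
  [/\ A !=set0, open A & connected A].

(* The curve is the restriction of g to [a, b]; its values elsewhere are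
   irrelevant. *)
Definition curve_in (R : realType) (n : nat) (A : set 'rV[R]_n)
    (a b : R) (g : R -> 'rV[R]_n) : Prop :=
  [/\ a <= b, {within `[a, b], continuous g} & g @` `[a, b] `<=` A].

(* [itv_partition a b s] says that a :: s is strictly increasing and ends at b;
   this is the R^n-valued analogue of [variation] and [total_variation]. *)
Definition polygonal_length (R : realType) (n : nat)
    (a b : R) (g : R -> 'rV[R]_n) (s : seq R) : R :=
  let t := nth b (a :: s) in
  \sum_(0 <= i < size s) enorm (g (t i.+1) - g (t i)).

Definition curve_length (R : realType) (n : nat)
    (a b : R) (g : R -> 'rV[R]_n) : \bar R :=
  ereal_sup [set (polygonal_length a b g s)%:E | s in itv_partition a b].

Definition rectifiable (R : realType) (n : nat)
    (a b : R) (g : R -> 'rV[R]_n) : Prop :=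
  (curve_length a b g < +oo)%E.

Definition locally_lipschitz (R : realType) (n : nat)
    (A : set 'rV[R]_n) (f : 'rV[R]_n -> 'rV[R]_n) : Prop :=
  forall x, A x -> exists (U : set 'rV[R]_n) (L : R), nbhs x U /\
    forall y z, (U `&` A) y -> (U `&` A) z ->
      enorm (f y - f z) <= L * enorm (y - z).

(* A pair B stands for the closed box with lower corner B.1 and upper corner
   B.2, which is empty, with volume 0, as soon as some side is negative. *)
Definition closed_box (R : realType) (n : nat)
    (B : 'rV[R]_n * 'rV[R]_n) : set 'rV[R]_n :=
  [set x | forall i : 'I_n, B.1 ord0 i <= x ord0 i <= B.2 ord0 i].

Definition box_volume (R : realType) (n : nat)
    (B : 'rV[R]_n * 'rV[R]_n) : R :=
  \prod_(i < n) Num.max 0 (B.2 ord0 i - B.1 ord0 i).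

(* The library has Lebesgue measure on R only.  This is Lebesgue outer measure
   on R^n; a set is Lebesgue null if and only if its outer measure is 0. *)
Definition lebesgue_outer (R : realType) (n : nat)
    (A : set 'rV[R]_n) : \bar R :=
  ereal_inf [set (\sum_(0 <= k <oo) (box_volume (B k))%:E)%E |
    B in [set B : nat -> 'rV[R]_n * 'rV[R]_n |
           A `<=` \bigcup_k closed_box (B k)]].

Definition ae_on (R : realType) (n : nat)
    (A : set 'rV[R]_n) (P : 'rV[R]_n -> Prop) : Prop :=
  lebesgue_outer [set x | A x /\ ~ P x] = 0%E.

(* Main.v *)
(* Since f distorts lengths of segments by at most M, it is M-Lipschitz on every
   cube contained in Omega.  Fix such a cube Q.  The averages of the partial
   derivatives of f over the dyadic subcubes of Q are computed from f alone, by
   the fundamental theorem of calculus, as differences of averages over opposite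
   faces; they form a bounded vector-valued martingale G on the dyadic tree.  By
   L^2 convergence of G and the maximal inequality, almost every x has the
   following property: for every delta there is a matrix C such that all small
   dyadic cubes P near x have energy (the supremum over generations of the mean
   square of G - C over the subcubes of P) at most delta.  Walking along a grid
   of small cubes then shows that f is affine near x up to an arbitrarily small
   relative error, hence differentiable at x with derivative close to C.

   For the lower bound, average over all segments of a given integer direction e
   in a cube P of small energy: some segment has an image of length at most
   |eC| + O(sqrt delta) times its own scale, at a given dyadic resolution and
   then, by compactness, at all of them.  Hence |eC| + O(sqrt delta) >= |e| / M,
   which passes to the derivative and to all directions by homogeneity.

   All exceptional sets are covered explicitly by dyadic cubes, so that only the
   countable subadditivity of Lebesgue outer measure is needed. *)

Require Import Defs.
From HB Require Import structures.
From mathcomp Require Import all_boot all_order all_algebra.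
From mathcomp Require Import all_classical all_reals all_analysis.
From mathcomp Require Import ring lra zify.

Import Order.TTheory GRing.Theory Num.Theory.
Import numFieldNormedType.Exports.

Local Open Scope classical_set_scope.
Local Open Scope ring_scope.

Set Implicit Arguments.
Unset Strict Implicit.
Unset Printing Implicit Defensive.

(** * Lebesgue outer measure *)

Section OuterMeasure.
Context (R : realType) (n : nat).
Implicit Types (A B : set 'rV[R]_n).

Lemma box_volume_ge0 (B : 'rV[R]_n * 'rV[R]_n) : 0 <= box_volume B.
Proof. by apply: prodr_ge0 => i _; rewrite le_max lexx. Qed.

Local Open Scope ereal_scope.

Lemma lebesgue_outer_ge0 A : 0 <= lebesgue_outer A.
Proof.
apply: le_ereal_inf_tmp => _ [B _ <-]; apply: nneseries_ge0 => k _ _.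
by rewrite lee_fin box_volume_ge0.
Qed.

Lemma le_lebesgue_outer A B : A `<=` B -> lebesgue_outer A <= lebesgue_outer B.
Proof.
move=> AB; apply/ereal_inf_le_tmp => _ [C BC <-]; exists C => //=.
exact: subset_trans AB BC.
Qed.

Lemma lebesgue_outer_bigcup (A : (set 'rV[R]_n)^nat) :
  lebesgue_outer (\bigcup_k A k) <= \sum_(k <oo) lebesgue_outer (A k).
Proof.
have [[i ioo]|] := pselect (exists i, lebesgue_outer (A i) = +oo).
  rewrite (eseries_pinfty _ _ ioo) ?leey// => k _.
  by rewrite -ltNye (lt_le_trans _ (lebesgue_outer_ge0 _)).
rewrite -forallNE => Aoo; apply/lee_addgt0Pr => e e0.
rewrite (le_trans _ (epsilon_trick _ _ (ltW e0)))//; last first.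
  by move=> k; exact: lebesgue_outer_ge0.
have Aepsilon k : exists B : nat -> 'rV[R]_n * 'rV[R]_n,
    A k `<=` \bigcup_j closed_box (B j) /\
    \sum_(j <oo) (box_volume (B j))%:E <=
      lebesgue_outer (A k) + (e / (2 ^ k.+1)%:R)%:E.
  have Afin : lebesgue_outer (A k) \is a fin_num.
    rewrite ge0_fin_numE ?lebesgue_outer_ge0// ltey.
    by apply/eqP; exact: Aoo.
  have d0 : (0 < e / (2 ^ k.+1)%:R)%R by rewrite divr_gt0// ltr0n expn_gt0.
  have [_ [B AB <-] /ltW Be] := lb_ereal_inf_adherent d0 Afin.
  by exists B.
have [B BP] := choice Aepsilon.
pose vol (p : nat * nat) : \bar R := (box_volume (B p.1 p.2))%:E.
have vol0 p : 0 <= vol p by rewrite lee_fin box_volume_ge0.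
(* The countably many covers are merged into a single sequence along a bijection [h] from nat onto
   pairs. *)
have /card_esym/ppcard_eqP[h] := card_nat2.
apply: (@le_trans _ _ (\sum_(k <oo) \sum_(j <oo) vol (k, j))); last first.
  by apply: lee_nneseries => k *; [exact: nneseries_ge0|exact: (BP k).2].
apply: ereal_inf_le.
exists (\sum_(k <oo) vol (h k)).
  exists (fun k => B (h k).1 (h k).2) => //= x [k _ /(BP k).1[j _ xj]].
  by exists (h^-1%FUN (k, j)) => //; rewrite /= invK ?inE.
rewrite nneseries_esumT// -(@reindex_esum _ _ _ setT setT h vol)//.
rewrite le_eqVlt; apply/orP; left; apply/eqP.
rewrite (_ : [set: nat * nat] = [set: nat] `*`` (fun=> [set: nat])); last first.
  by apply/seteqP; split.
rewrite -(@esum_esum _ _ _ setT (fun=> setT) (fun k j => vol (k, j)))//.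
rewrite nneseries_esumT; last by move=> k; exact: nneseries_ge0.
by apply: eq_esum => k _; rewrite nneseries_esumT.
Qed.

Lemma lebesgue_outer_null_bigcup (A : (set 'rV[R]_n)^nat) :
  (forall k, lebesgue_outer (A k) = 0) -> lebesgue_outer (\bigcup_k A k) = 0.
Proof.
move=> A0; apply/eqP; rewrite eq_le lebesgue_outer_ge0 andbT.
by rewrite (le_trans (lebesgue_outer_bigcup A))// eseries0.
Qed.

Lemma lebesgue_outer_null_subset A B :
  A `<=` B -> lebesgue_outer B = 0 -> lebesgue_outer A = 0.
Proof.
move=> /le_lebesgue_outer AB B0; apply/eqP.
by rewrite eq_le lebesgue_outer_ge0 andbT -B0.
Qed.

Hypothesis n_gt0 : (0 < n)%N.

Lemma lebesgue_outer_box (B : 'rV[R]_n * 'rV[R]_n) :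
  lebesgue_outer (closed_box B) <= (box_volume B)%:E.
Proof.
pose i0 := Ordinal n_gt0.
(* A cover is an infinite sequence, so [B] is padded with the empty box [Z]. Its volume vanishes
   because n > 0; an empty product would be 1. *)
pose Z : 'rV[R]_n * 'rV[R]_n := (0, const_mx (-1))%R.
have volZ : box_volume Z = 0%R.
  by rewrite /box_volume (bigD1 i0)//= !mxE subr0 max_l ?mul0r// lerN10.
apply: ereal_inf_lbound; exists (fun k => if k is 0%N then B else Z).
  by move=> x Bx; exists 0%N.
rewrite nneseries_recl//=; last by move=> k _; rewrite lee_fin box_volume_ge0.
rewrite eseries0 ?adde0// => -[|k]//= _ _.
by rewrite volZ.
Qed.

Lemma lebesgue_outer0 : lebesgue_outer (@set0 'rV[R]_n) = 0.
Proof.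
pose i0 := Ordinal n_gt0; pose Z : 'rV[R]_n * 'rV[R]_n := (0, 0)%R.
apply: (@lebesgue_outer_null_subset _ (closed_box Z)) => //; apply/eqP.
rewrite eq_le lebesgue_outer_ge0 andbT (le_trans (lebesgue_outer_box Z))//.
by rewrite lee_fin /box_volume (bigD1 i0)//= subrr max_l ?mul0r.
Qed.

Lemma lebesgue_outerU A B :
  lebesgue_outer (A `|` B) <= lebesgue_outer A + lebesgue_outer B.
Proof.
rewrite -bigcup2E (le_trans (lebesgue_outer_bigcup _))//.
rewrite (nneseries_split 0 2); last by move=> k _; exact: lebesgue_outer_ge0.
rewrite add0n big_nat_recl//= big_nat1 eseries0 ?adde0// => -[|[|k]]//= _ _.
exact: lebesgue_outer0.
Qed.

Lemma lebesgue_outer_bigcup_fin (I : finType) (A : I -> set 'rV[R]_n) :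
  lebesgue_outer (\bigcup_i A i) <= \sum_i lebesgue_outer (A i).
Proof.
rewrite (@le_trans _ _ (lebesgue_outer (\big[setU/set0]_i A i)))//.
  by apply: le_lebesgue_outer => x [i _ Ax]; rewrite -bigcup_seq; exists i => //=; rewrite mem_index_enum.
elim/big_ind2 : _ => [|B a C b Ba Cb|//]; first by rewrite lebesgue_outer0.
by rewrite (le_trans (lebesgue_outerU _ _))// leeD.
Qed.

End OuterMeasure.

(** * Dyadic martingales *)

Section DyadicMeans.
Context (R : realType) (n : nat).
Local Notation bits := {ffun 'I_n -> bool}.
Local Notation vec := 'rV[R]_n.
(* Functions of a cube, given by its side and its lower corner. *)
Local Notation cubefun := (R -> vec -> R).
Implicit Types (r L : R) (c : vec) (Phi Psi : cubefun) (p : bits -> bits).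

Definition bitvec (s : bits) : vec := \row_i (s i)%:R.

Definition mean (F : bits -> R) : R := (2 ^+ n)^-1 * \sum_s F s.

Lemma mean_cst (a : R) : mean (fun=> a) = a.
Proof.
rewrite /mean sumr_const card_ffun card_bool card_ord -[a *+ _]mulr_natl natrX.
by rewrite mulKf.
Qed.

Lemma eq_mean (F G : bits -> R) : F =1 G -> mean F = mean G.
Proof. by move=> FG; congr (_ * _); apply: eq_bigr => s _; exact: FG. Qed.

Lemma meanD (F G : bits -> R) : mean (fun s => F s + G s) = mean F + mean G.
Proof. by rewrite /mean big_split mulrDr. Qed.

Lemma meanZ (a : R) (F : bits -> R) : mean (fun s => a * F s) = a * mean F.
Proof. by rewrite /mean -mulr_sumr mulrCA. Qed.

Lemma meanB (F G : bits -> R) : mean (fun s => F s - G s) = mean F - mean G.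
Proof. by rewrite /mean sumrB mulrBr. Qed.

Lemma mean_sum (I : finType) (F : I -> bits -> R) :
  mean (fun s => \sum_i F i s) = \sum_i mean (F i).
Proof. by rewrite /mean exchange_big mulr_sumr. Qed.

Lemma le_mean (F G : bits -> R) : (forall s, F s <= G s) -> mean F <= mean G.
Proof.
move=> FG; rewrite ler_wpM2l ?invr_ge0 ?exprn_ge0//.
by apply: ler_sum => s _; exact: FG.
Qed.

Lemma ler_norm_mean (F : bits -> R) (a : R) :
  (forall s, `|F s| <= a) -> `|mean F| <= a.
Proof.
move=> Fa; rewrite ler_norml; apply/andP; split.
  rewrite -(mean_cst (- a)); apply: le_mean => s.
  by have := Fa s; rewrite ler_norml => /andP[].
rewrite -[X in _ <= X]mean_cst; apply: le_mean => s.
by have := Fa s; rewrite ler_norml => /andP[].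
Qed.

(** Jensen's inequality: the difference of the two sides is a variance. *)
Lemma mean_sqr (F : bits -> R) : mean F ^+ 2 <= mean (fun s => F s ^+ 2).
Proof.
rewrite -subr_ge0.
have -> : mean (fun s => F s ^+ 2) - mean F ^+ 2 =
    mean (fun s => (F s - mean F) ^+ 2).
  rewrite (@eq_mean (fun s => (F s - mean F) ^+ 2)
    (fun s => F s ^+ 2 + (- (2 * mean F) * F s + mean F ^+ 2))); last first.
    by move=> s; ring.
  by rewrite !meanD meanZ mean_cst; ring.
by rewrite -(mean_cst 0) le_mean// => s; rewrite sqr_ge0.
Qed.

Lemma cvg_mean (F : bits -> nat -> R) (l : bits -> R) :
  (forall s, F s @ \oo --> l s) ->
  (fun k => mean (F ^~ k)) @ \oo --> mean l.
Proof.
move=> Fl; apply: cvgM; first exact: cvg_cst.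
by apply: cvg_big => [|s _]; [exact: add_continuous|exact: Fl].
Qed.

(* For p = id this is the mean over the 2^n dyadic children; forcing a bit to 0
   by p restricts the mean to the children that touch a lower face. *)
Definition sub_mean p Phi : cubefun :=
  fun r c => mean (fun s => Phi (r / 2) (c + (r / 2) *: bitvec (p s))).

Lemma le_sub_mean p Phi Psi :
  (forall r c, 0 < r -> Phi r c <= Psi r c) ->
  forall j r c, 0 < r ->
    iter j (sub_mean p) Phi r c <= iter j (sub_mean p) Psi r c.
Proof.
move=> PhiPsi; elim=> [|j IH] r c r0 /=; first exact: PhiPsi.
by apply: le_mean => s; apply: IH; rewrite divr_gt0.
Qed.

Lemma eq_sub_mean p Phi Psi :
  (forall r c, 0 < r -> Phi r c = Psi r c) ->
  forall j r c, 0 < r ->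
    iter j (sub_mean p) Phi r c = iter j (sub_mean p) Psi r c.
Proof.
by move=> PP j r c r0; apply/eqP; rewrite eq_le !le_sub_mean// => *; rewrite PP.
Qed.

Lemma sub_mean_cst p a j r c : iter j (sub_mean p) (fun _ _ => a) r c = a.
Proof.
elim: j r c => [|j IH] r c //=.
by rewrite /sub_mean -[RHS]mean_cst; apply: eq_mean => s; exact: IH.
Qed.

Lemma sub_meanB p Phi Psi j r c :
  iter j (sub_mean p) (fun r c => Phi r c - Psi r c) r c =
  iter j (sub_mean p) Phi r c - iter j (sub_mean p) Psi r c.
Proof.
elim: j r c => [|j IH] r c //=.
by rewrite /sub_mean -meanB; apply: eq_mean => s; exact: IH.
Qed.

(** Lipschitz continuity for the sup distance; any upper bound [rho] of the coordinate differences
    stands for the distance, so that no maximum has to be computed. *)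
Definition suplip L (phi : vec -> R) := forall (x y : vec) (rho : R), 0 <= rho ->
  (forall i, `|x ord0 i - y ord0 i| <= rho) -> `|phi x - phi y| <= L * rho.

(** * Integral means as limits of dyadic Riemann sums *)

Section Averages.
Context (p : bits -> bits) (L : R) (phi : vec -> R).
Hypotheses (L_ge0 : 0 <= L) (phi_lip : suplip L phi).

Let avg j := iter j (sub_mean p) (fun _ c => phi c).

Lemma suplip_bitvec s r c : `|phi (c + r *: bitvec s) - phi c| <= L * `|r|.
Proof.
apply: phi_lip => // i; rewrite !mxE addrAC subrr add0r normrM.
by rewrite ler_piMr//; case: (s i); rewrite ?normr1// normr0.
Qed.

Let avgS j r c :
  avg j.+1 r c = mean (fun s => avg j (r / 2) (c + (r / 2) *: bitvec (p s))).
Proof. by []. Qed.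

(** The bound reproduces itself: half of it comes from the induction hypothesis on a child, half
    from the displacement of the child's corner. *)
Lemma avg_near j r c : `|avg j r c - phi c| <= L * `|r|.
Proof.
elim: j r c => [|j IH] r c; first by rewrite subrr normr0 mulr_ge0.
rewrite avgS -[X in _ - X]mean_cst -meanB; apply: ler_norm_mean => s.
rewrite -(subrKA (phi (c + (r / 2) *: bitvec (p s)))).
rewrite (le_trans (ler_normD _ _))//.
apply: le_trans (lerD (IH _ _) (suplip_bitvec _ _ _)) _.
by rewrite normrM (ger0_norm (_ : 0 <= 2^-1))// -mulrDr -splitr.
Qed.

Lemma avg_step j r c :
  `|avg j.+1 r c - avg j r c| <= L * `|r| / 2 ^+ j.+1.
Proof.
elim: j r c => [|j IH] r c.
  rewrite /avg /= /sub_mean -[X in _ - X]mean_cst -meanB.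
  apply: ler_norm_mean => s; rewrite (le_trans (suplip_bitvec _ _ _))//.
  by rewrite normrM (ger0_norm (_ : 0 <= 2^-1))// expr1 mulrA.
rewrite avgS [X in _ - X]avgS -meanB.
apply: ler_norm_mean => s; rewrite (le_trans (IH _ _))//.
rewrite normrM (ger0_norm (_ : 0 <= 2^-1))// [in leRHS]exprS invfM.
by rewrite !mulrA.
Qed.

Lemma cvg_halving (a : R) : (fun j => a / 2 ^+ j) @ \oo --> (0 : R).
Proof.
rewrite -(mulr0 a); apply: cvgM; first exact: cvg_cst.
rewrite (_ : (fun j => _) = (fun j => (2^-1 : R) ^+ j)); last first.
  by apply/funext => j; rewrite exprVn.
by apply: cvg_expr; rewrite ger0_norm ?invr_ge0// invf_lt1// ltr1n.
Qed.

Lemma cvg_avg r c : cvgn (fun j => avg j r c).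
Proof.
pose a := L * `|r|.
(* By [avg_step] an increment is at most [a / 2 ^+ j.+1], so adding [a / 2 ^+ j] makes the sequence
   nonincreasing; [avg_near] bounds it below. *)
have: cvgn (fun j => avg j r c + a / 2 ^+ j).
  apply: nonincreasing_is_cvgn.
    apply/nonincreasing_seqP => j; rewrite -lerBrDr -addrA.
    have -> : a / 2 ^+ j - a / 2 ^+ j.+1 = a / 2 ^+ j.+1.
      rewrite exprS invfM; set b := _^-1; lra.
    by rewrite -lerBlDl (le_trans (ler_norm _))// avg_step.
  exists (phi c - a) => _ [j _ <-].
  rewrite (@le_trans _ _ (avg j r c))// ?lerDl ?divr_ge0 ?mulr_ge0 ?exprn_ge0//.
  rewrite lerBlDr -lerBlDl (le_trans (ler_norm _))// distrC.
  exact: avg_near.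
move=> H; rewrite (_ : (fun j => _) =
  (fun j => (avg j r c + a / 2 ^+ j) - a / 2 ^+ j)); last first.
  by apply/funext => j; rewrite addrK.
by apply: is_cvgB => //; apply/cvg_ex; exists 0; exact: cvg_halving.
Qed.

(** The integral mean of [phi] over the cube for [p = id], and over a lower face when [p] clears one
    bit. *)
Definition average r c : R := limn (fun j => avg j r c).

Lemma cvg_average r c : (fun j => avg j r c) @ \oo --> average r c.
Proof. exact: cvg_avg. Qed.

Lemma average_near r c : `|average r c - phi c| <= L * `|r|.
Proof.
have H : (fun j => `|avg j r c - phi c|) @ \oo --> `|average r c - phi c|.
  by apply: cvg_norm; apply: cvgB; [exact: cvg_average|exact: cvg_cst].
rewrite -(cvg_lim _ H)//; apply: limr_le; first by apply/cvg_ex; eexists; exact: H.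
by apply: nearW => j; exact: avg_near.
Qed.

Lemma average_sub_mean r c : average r c = sub_mean p average r c.
Proof.
have H : (fun j => avg j.+1 r c) @ \oo --> average r c.
  by rewrite (cvg_shiftS (fun j => avg j r c)); exact: cvg_average.
rewrite -(cvg_lim _ H)//; apply: cvg_lim => //.
by apply: cvg_mean => s; exact: cvg_average.
Qed.

Lemma avg_lip j r : suplip L (avg j r).
Proof.
elim: j r => [|j IH] r; first exact: phi_lip.
move=> x y rho rho0 xy; rewrite /avg /= /sub_mean -meanB.
apply: ler_norm_mean => s; apply: IH => // i.
by rewrite !mxE opprD addrACA subrr addr0.
Qed.

Lemma average_lip r : suplip L (average r).
Proof.
move=> x y rho rho0 xy.
have H : (fun j => `|avg j r x - avg j r y|) @ \oo -->
    `|average r x - average r y|.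
  by apply: cvg_norm; apply: cvgB; exact: cvg_average.
rewrite -(cvg_lim _ H)//; apply: limr_le; first by apply/cvg_ex; eexists; exact: H.
by apply: nearW => j; exact: avg_lip.
Qed.

End Averages.

Definition child_mean := sub_mean id.

Definition zero_bit (i : 'I_n) (s : bits) : bits :=
  [ffun k => (k != i) && s k].

Definition flip_bit (i : 'I_n) (s : bits) : bits :=
  [ffun k => (k == i) (+) s k].

Lemma flip_bitK i : involutive (flip_bit i).
Proof. by move=> s; apply/ffunP => k; rewrite !ffunE addbA addbb. Qed.

(** * Mean slopes of a Lipschitz function form a martingale *)

Section Slopes.
Context (L : R) (phi : vec -> R).
Hypotheses (L_ge0 : 0 <= L) (phi_lip : suplip L phi).
Implicit Types (i : 'I_n).

Definition face_average i : cubefun := average (zero_bit i) phi.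

(* The mean over the cube of the i-th partial derivative of phi. *)
Definition slope i : cubefun := fun r c =>
  (face_average i r (c + r *: delta_mx ord0 i) - face_average i r c) / r.

Lemma slope_bound i r c : 0 < r -> `|slope i r c| <= L.
Proof.
move=> r0; rewrite normrM normfV (gtr0_norm r0) ler_pdivrMr//.
apply: average_lip => //; first exact: ltW.
move=> k; rewrite !mxE eqxx/= addrAC subrr add0r normrM (gtr0_norm r0).
by rewrite ler_piMr ?(ltW r0)//; case: (k == i); rewrite ?normr1 ?normr0.
Qed.

(** Two children adjacent in direction i share a face, whose averages cancel; what remains is the
    difference between the opposite faces of the parent. *)
Lemma slope_martingale i r c : 0 < r ->
  child_mean (slope i) r c = slope i r c.
Proof.
move=> r0; have r2 : r / 2 != 0 by rewrite mulf_neq0 ?invr_eq0 ?gt_eqF.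
pose H u := face_average i (r / 2) (c + (r / 2) *: u).
pose e : vec := delta_mx ord0 i.
have -> : slope i r c =
    mean (fun s => H (bitvec (zero_bit i s) + e + e) - H (bitvec (zero_bit i s))) / r.
  rewrite meanB /slope /face_average.
  rewrite (average_sub_mean (zero_bit i) L_ge0 phi_lip r c).
  rewrite (average_sub_mean (zero_bit i) L_ge0 phi_lip r (c + r *: delta_mx ord0 i)).
  congr ((_ - _) / _); apply: eq_mean => s.
  rewrite /H /e /face_average; congr (average _ _ _ _).
  by apply/rowP => k; rewrite !mxE; field.
have -> : child_mean (slope i) r c =
    mean (fun s => (H (bitvec s + e) - H (bitvec s)) * 2) / r.
  rewrite mulrC -meanZ; apply: eq_mean => s.
  rewrite /slope /H -/e scalerDr addrA; field.
  by rewrite gt_eqF.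
congr (_ / _); rewrite /mean; congr (_ * _).
(* Each child is paired with its neighbour in direction i, so that each term of the new sum
   telescopes. *)
have -> : \sum_s (H (bitvec s + e) - H (bitvec s)) * 2 =
    \sum_s ((H (bitvec s + e) - H (bitvec s)) +
            (H (bitvec (flip_bit i s) + e) - H (bitvec (flip_bit i s)))).
  rewrite big_split/= -mulr_suml mulr_natr mulr2n; congr (_ + _).
  by rewrite [LHS](reindex_inj (can_inj (flip_bitK i))).
apply: eq_bigr => s _.
have [si|si] := boolP (s i).
  have -> : bitvec s = bitvec (zero_bit i s) + e.
    apply/rowP => k; rewrite !mxE !ffunE eqxx/=.
    by case: eqP => [->|_] /=; rewrite ?si ?add0r ?addr0.
  have -> : bitvec (flip_bit i s) = bitvec (zero_bit i s).
    apply/rowP => k; rewrite !mxE !ffunE.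
    by case: eqP => [->|_] /=; rewrite ?si.
  by ring.
have -> : bitvec (flip_bit i s) = bitvec (zero_bit i s) + e.
  apply/rowP => k; rewrite !mxE !ffunE eqxx/=.
  by case: eqP => [->|_] /=; rewrite ?(negbTE si) ?add0r ?addr0.
have -> : bitvec (zero_bit i s) = bitvec s.
  apply/rowP => k; rewrite !mxE !ffunE.
  by case: eqP => [->|_] /=; rewrite ?(negbTE si).
by ring.
Qed.

End Slopes.

(** * Energy and variance of a bounded martingale *)

Section Energy.
Context (I : finType) (G : I -> cubefun) (L : R).
Hypothesis G_martingale :
  forall a r c, 0 < r -> child_mean (G a) r c = G a r c.
Hypothesis G_bound : forall a r c, 0 < r -> `|G a r c| <= L.
Implicit Type C : I -> R.

Definition sqdist C : cubefun := fun r c => \sum_a (G a r c - C a) ^+ 2.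

Lemma sqdist_ge0 C r c : 0 <= sqdist C r c.
Proof. by apply: sumr_ge0 => a _; rewrite sqr_ge0. Qed.

(** Jensen's inequality: the squared distance of a martingale to a constant is a submartingale. *)
Lemma sqdist_child_mean C r c : 0 < r ->
  sqdist C r c <= child_mean (sqdist C) r c.
Proof.
move=> r0; rewrite /child_mean /sub_mean /sqdist mean_sum.
apply: ler_sum => a _; rewrite -G_martingale// -[X in _ - X]mean_cst -meanB.
exact: mean_sqr.
Qed.

Let energy_seq C r c j := iter j child_mean (sqdist C) r c.

Lemma energy_seq_nondecreasing C r c : 0 < r ->
  nondecreasing_seq (energy_seq C r c).
Proof.
move=> r0; apply/nondecreasing_seqP => j; rewrite /energy_seq iterSr.
by apply: le_sub_mean => // ? ?; exact: sqdist_child_mean.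
Qed.

Lemma energy_seq_bound C r c j : 0 < r ->
  energy_seq C r c j <= \sum_a (L + `|C a|) ^+ 2.
Proof.
move=> r0; rewrite -[leRHS](sub_mean_cst id _ j r c); apply: le_sub_mean => //.
move=> r' c' r'0; apply: ler_sum => a _.
rewrite -real_normK ?num_real// lerXn2r ?nnegrE ?normr_ge0//.
  by rewrite addr_ge0// (le_trans _ (G_bound a c' r'0)).
by rewrite (le_trans (ler_normB _ _))// lerD2r G_bound.
Qed.

(* By Jensen this limit is a supremum. *)
Definition energy C r c : R := limn (energy_seq C r c).

Lemma cvg_energy C r c : 0 < r -> energy_seq C r c @ \oo --> energy C r c.
Proof.
move=> r0; apply: nondecreasing_is_cvgn; first exact: energy_seq_nondecreasing.
exists (\sum_a (L + `|C a|) ^+ 2) => _ [j _ <-]; exact: energy_seq_bound.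
Qed.

Lemma energy_ge C r c j : 0 < r ->
  iter j child_mean (sqdist C) r c <= energy C r c.
Proof.
move=> r0; apply: nondecreasing_cvgn_le; first exact: energy_seq_nondecreasing.
by apply/cvg_ex; eexists; exact: cvg_energy.
Qed.

Lemma energy_ge0 C r c : 0 < r -> 0 <= energy C r c.
Proof. by move=> r0; apply: le_trans (energy_ge C c 0 r0); exact: sqdist_ge0. Qed.

Lemma energy_martingale C r c : 0 < r ->
  child_mean (energy C) r c = energy C r c.
Proof.
move=> r0.
have H : (fun j => energy_seq C r c j.+1) @ \oo --> energy C r c.
  by rewrite (cvg_shiftS (energy_seq C r c)); exact: cvg_energy.
rewrite -(cvg_lim _ H)//; apply/esym/cvg_lim => //.
by apply: cvg_mean => s; apply: cvg_energy; rewrite divr_gt0.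
Qed.

(** After expansion of the square, the martingale property reduces the cross term to the value of
    [G] on the cube itself; only the first term depends on j. *)
Lemma energy_seqE C r c j : 0 < r ->
  energy_seq C r c j = energy_seq (fun=> 0) r c j -
    2 * \sum_a C a * G a r c + \sum_a C a ^+ 2.
Proof.
rewrite /energy_seq; elim: j r c => [|j IH] r c r0 /=.
  rewrite /sqdist mulr_sumr -sumrB -big_split; apply: eq_bigr => a _ /=.
  by rewrite subr0; ring.
rewrite {1}/child_mean /sub_mean.
under eq_mean do rewrite IH ?divr_gt0//.
rewrite meanD mean_cst meanB meanZ mean_sum; congr (_ - _ * _ + _).
apply: eq_bigr => a _; rewrite meanZ; congr (_ * _).
exact: G_martingale.
Qed.

Definition variance r c : R := energy (fun a => G a r c) r c.

Lemma varianceE r c : 0 < r ->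
  variance r c = energy (fun=> 0) r c - sqdist (fun=> 0) r c.
Proof.
move=> r0; apply: cvg_lim => //.
rewrite (_ : energy_seq _ r c =
  fun j => energy_seq (fun=> 0) r c j - sqdist (fun=> 0) r c); last first.
  apply/funext => j; rewrite energy_seqE// -addrA; congr (_ + _).
  rewrite mulr_sumr -sumrN -big_split -sumrN; apply: eq_bigr => a _ /=.
  by rewrite subr0; ring.
by apply: cvgB; [exact: cvg_energy|exact: cvg_cst].
Qed.

(** L^2 convergence: by [varianceE] the mean variance over generation m is what the mean square of
    [G] still has to gain after generation m. *)
Lemma cvg_variance r c : 0 < r ->
  (fun m => iter m child_mean variance r c) @ \oo --> (0 : R).
Proof.
move=> r0; rewrite -(subrr (energy (fun=> 0) r c)).
rewrite (_ : (fun m => _) =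
  fun m => energy (fun=> 0) r c - energy_seq (fun=> 0) r c m); last first.
  apply/funext => m; rewrite (eq_sub_mean _ varianceE)// sub_meanB; congr (_ - _).
  elim: m r c r0 => [//|m IH] r c r0; rewrite iterSr -IH//.
  by apply: eq_sub_mean => // r' c'; exact: energy_martingale.
by apply: cvgB; [exact: cvg_cst|exact: cvg_energy].
Qed.

End Energy.
End DyadicMeans.

(** * Maximal inequality and nontangential convergence *)

Section DyadicCubes.
Context (R : realType) (n : nat).
Local Notation bits := {ffun 'I_n -> bool}.
Local Notation vec := 'rV[R]_n.
Implicit Types (r K : R) (c a x : vec).

(** A subcube is represented by its lower corner [a] alone; its side is [r / 2 ^+ j]. *)
Fixpoint subcube (j : nat) r c a : Prop :=
  if j is j'.+1 then
    exists s : bits, subcube j' (r / 2) (c + (r / 2) *: bitvec R s) a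
  else a = c.

Lemma addZmxE r c (v : vec) i : (c + r *: v) ord0 i = c ord0 i + r * v ord0 i.
Proof. by rewrite !mxE. Qed.

Lemma half_pow r j : r / 2 / 2 ^+ j = r / 2 ^+ j.+1.
Proof. by rewrite exprS invfM mulrA. Qed.

(** The first choice of a child is the leading binary digit of the integer coordinates, hence its
    weight 2^j in the induction. *)
Lemma subcube_coord j r c a : subcube j r c a ->
  exists z : 'I_n -> nat, (forall i, (z i < 2 ^ j)%N) /\
    forall i, a ord0 i = c ord0 i + r / 2 ^+ j * (z i)%:R.
Proof.
elim: j r c => [|j IH] r c /=.
  by move=> ->; exists (fun=> 0%N); split => // i; rewrite mulr0 addr0.
move=> [s /IH[z [zlt az]]].
exists (fun i => z i + s i * 2 ^ j)%N; split => i.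
  have := zlt i; rewrite expnS mul2n -addnn; case: (s i) => /=; lia.
rewrite az !mxE half_pow exprS natrD natrM natrX; field.
by rewrite expf_neq0.
Qed.

Lemma coord_subcube j r c a (z : 'I_n -> nat) :
  (forall i, (z i < 2 ^ j)%N) ->
  (forall i, a ord0 i = c ord0 i + r / 2 ^+ j * (z i)%:R) -> subcube j r c a.
Proof.
elim: j r c z => [|j IH] r c z zlt az /=.
  apply/rowP => i; rewrite az; have := zlt i.
  by rewrite expn0 ltnS leqn0 => /eqP ->; rewrite mulr0 addr0.
pose s : bits := [ffun i => 2 ^ j <= z i]%N.
exists s; apply: (IH _ _ (fun i => z i - s i * 2 ^ j)%N) => i.
  rewrite ffunE; have := zlt i; rewrite expnS; case: leqP => /=; lia.
have szi : (s i * 2 ^ j <= z i)%N by rewrite ffunE; case: leqP => /=; lia.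
rewrite az !mxE half_pow exprS natrB// natrM natrX; field.
by rewrite expf_neq0.
Qed.

(* [dilate 0 r c] is the cube of side r and lower corner c. *)
Definition dilate K r c : set vec :=
  closed_box (c - const_mx (K * r), c + const_mx ((K + 1) * r)).

Lemma dilateP K r c x : dilate K r c x <->
  forall i, c ord0 i - K * r <= x ord0 i <= c ord0 i + (K + 1) * r.
Proof. by split=> H i; have := H i; rewrite !mxE. Qed.

Lemma dilate_volume K r c : 0 <= K -> 0 <= r ->
  box_volume (c - const_mx (K * r), c + const_mx ((K + 1) * r)) =
  ((2 * K + 1) * r) ^+ n.
Proof.
move=> K0 r0; rewrite /box_volume -[n in RHS]card_ord -prodr_const.
apply: eq_bigr => i _; rewrite !mxE /=.
rewrite (_ : _ - _ = (2 * K + 1) * r); last by ring.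
by rewrite max_r// mulr_ge0// addr_ge0// mulr_ge0.
Qed.

Lemma bitvec_bounds (s : bits) i : 0 <= bitvec R s ord0 i <= 1.
Proof. by rewrite mxE; case: (s i); rewrite /= ?lexx ?ler01. Qed.

Lemma dilate_child K r c (s : bits) : 0 <= K -> 0 < r ->
  dilate K (r / 2) (c + (r / 2) *: bitvec R s) `<=` dilate K r c.
Proof.
move=> K0 r0 x /dilateP xc; apply/dilateP => i.
move: (xc i) (bitvec_bounds s i); rewrite addZmxE.
move: (bitvec R s ord0 i) => b /andP[x1 x2] /andP[b0 b1].
by apply/andP; split; nra.
Qed.

Lemma dilate_subcube j K r c a : 0 <= K -> 0 < r ->
  subcube j r c a -> dilate K (r / 2 ^+ j) a `<=` dilate K r c.
Proof.
move=> K0; elim: j r c => [|j IH] r c r0 /=; first by move=> ->; rewrite divr1.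
move=> [s /IH]; rewrite half_pow => H x /H; rewrite divr_gt0// => /(_ isT).
exact: dilate_child.
Qed.

(** * The dyadic maximal inequality for supermartingales *)

Section MaximalInequality.
Context (K delta : R) (U : R -> vec -> R).
Hypotheses (n_gt0 : (0 < n)%N) (K_ge0 : 0 <= K) (delta_gt0 : 0 < delta).
Hypothesis U_ge0 : forall r c, 0 < r -> 0 <= U r c.
Hypothesis U_supermartingale : forall r c, 0 < r -> child_mean U r c <= U r c.

(* [first_bad j r c] is the union of the dilates of the subcubes of generation
   j on which U exceeds delta while it does not on their ancestors. *)
Fixpoint first_bad (j : nat) r c : set vec :=
  match j with
  | 0 => if delta < U r c then dilate K r c else set0
  | j'.+1 => if delta < U r c then set0 else
      \bigcup_(s : bits) first_bad j' (r / 2) (c + (r / 2) *: bitvec R s)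
  end.

Fixpoint first_bad_volume (j : nat) r c : R :=
  match j with
  | 0 => if delta < U r c then ((2 * K + 1) * r) ^+ n else 0
  | j'.+1 => if delta < U r c then 0 else
      \sum_(s : bits) first_bad_volume j' (r / 2) (c + (r / 2) *: bitvec R s)
  end.

Lemma first_bad_outer j r c : 0 < r ->
  (lebesgue_outer (first_bad j r c) <= (first_bad_volume j r c)%:E)%E.
Proof.
elim: j r c => [|j IH] r c r0 /=; case: ifP => _.
- rewrite -(dilate_volume c)//; last exact: ltW.
  exact: lebesgue_outer_box.
- by rewrite lebesgue_outer0.
- by rewrite lebesgue_outer0.
rewrite (le_trans (lebesgue_outer_bigcup_fin _ _))// -sumEFin.
by apply: lee_sum => s _; apply: IH; rewrite divr_gt0.
Qed.

(** A stopping-time argument. On a bad cube [U / delta] exceeds 1 and pays for the dilated volume;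
    otherwise the bounds for the 2^n children add up to the bound for the cube, by the
    supermartingale property. *)
Lemma sum_first_bad_volume d r c : 0 < r ->
  \sum_(0 <= j < d) first_bad_volume j r c <=
    ((2 * K + 1) * r) ^+ n * (U r c / delta).
Proof.
have K1 : 0 <= 2 * K + 1 by rewrite addr_ge0// mulr_ge0.
have bound_ge0 r' c' : 0 < r' -> 0 <= ((2 * K + 1) * r') ^+ n * (U r' c' / delta).
  move=> r'0; rewrite mulr_ge0 ?exprn_ge0 ?(mulr_ge0 K1) ?(ltW r'0)//.
  by rewrite divr_ge0 ?U_ge0 ?(ltW delta_gt0).
elim: d r c => [|d IH] r c r0; first by rewrite big_geq// bound_ge0.
rewrite big_nat_recl//=; case: ifPn => [bad|_].
  rewrite big1 ?addr0// ler_peMr ?exprn_ge0 ?mulr_ge0 ?(ltW r0)//.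
  by rewrite ler_pdivlMr// mul1r ltW.
rewrite add0r exchange_big/=.
apply: (@le_trans _ _ (\sum_(s : bits) ((2 * K + 1) * (r / 2)) ^+ n *
    (U (r / 2) (c + (r / 2) *: bitvec R s) / delta))).
  by apply: ler_sum => s _; apply: IH; rewrite divr_gt0.
rewrite -mulr_sumr -mulr_suml mulrA exprMn.
apply: (@le_trans _ _ (((2 * K + 1) * r) ^+ n * (child_mean U r c / delta))).
  rewrite /child_mean /sub_mean /mean [in leRHS]exprMn [in leLHS]exprMn exprVn.
  by rewrite le_eqVlt; apply/orP; left; apply/eqP; ring.
rewrite ler_wpM2l ?exprn_ge0 ?mulr_ge0 ?(ltW r0)// ler_wpM2r ?invr_ge0 ?(ltW delta_gt0)//.
exact: U_supermartingale.
Qed.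

(** The largest bad cube above [a] is counted by some [first_bad k], and its dilate contains the
    dilate of the smaller one. *)
Lemma bad_subset_first_bad j r c a : 0 < r ->
  subcube j r c a -> delta < U (r / 2 ^+ j) a ->
  dilate K (r / 2 ^+ j) a `<=` \bigcup_k first_bad k r c.
Proof.
elim: j r c => [|j IH] r c r0 ja bad.
  by move: ja bad => /= ->; rewrite divr1 => bad x ?; exists 0%N; rewrite //= bad.
move=> x xa; have [badr|goodr] := boolP (delta < U r c).
  by exists 0%N => //=; rewrite badr; exact: dilate_subcube ja _ xa.
case: ja => s ja; rewrite -half_pow in bad xa.
have [|k _ xk] := IH _ _ _ ja bad x xa; first by rewrite divr_gt0.
by exists k.+1 => //=; rewrite (negbTE goodr); exists s.
Qed.

Definition bad_points r c : set vec :=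
  [set x | exists j a, [/\ subcube j r c a, delta < U (r / 2 ^+ j) a &
    dilate K (r / 2 ^+ j) a x]].

Lemma maximal_inequality r c : 0 < r ->
  (lebesgue_outer (bad_points r c) <=
    (((2 * K + 1) * r) ^+ n * (U r c / delta))%:E)%E.
Proof.
move=> r0; apply: (@le_trans _ _ (lebesgue_outer (\bigcup_k first_bad k r c))).
  apply: le_lebesgue_outer => x [j [a [ja bad]]].
  exact: bad_subset_first_bad.
rewrite (le_trans (lebesgue_outer_bigcup _))//.
apply: lime_le; first by apply: is_cvg_nneseries => *; exact: lebesgue_outer_ge0.
apply: nearW => d; apply: (@le_trans _ _
  (\sum_(0 <= j < d) (first_bad_volume j r c)%:E)%E).
  by apply: lee_sum => j _; exact: first_bad_outer.
by rewrite sumEFin lee_fin; exact: sum_first_bad_volume.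
Qed.

End MaximalInequality.

Lemma hyperplane_null r c i (t : R) : 0 <= r ->
  lebesgue_outer [set x | dilate 0 r c x /\ x ord0 i = t] = 0%E.
Proof.
move=> r0; have n0 : (0 < n)%N by case: i => m; case: n.
pose B : vec * vec := (\row_k if k == i then t else c ord0 k,
                       \row_k if k == i then t else c ord0 k + r).
apply: (@lebesgue_outer_null_subset _ _ _ (closed_box B)).
  move=> x [/dilateP xc xt] k; have := xc k; rewrite !mxE add0r mul1r mul0r subr0.
  by case: eqP => [->|//]; rewrite xt lexx.
apply/eqP; rewrite eq_le lebesgue_outer_ge0 andbT.
rewrite (le_trans (lebesgue_outer_box n0 B))// lee_fin /box_volume (bigD1 i)//=.
by rewrite !mxE eqxx subrr maxxx mul0r.
Qed.

(** * Nontangential smallness of the energy *)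

Section Nontangential.
Context (I : finType) (G : I -> R -> vec -> R) (L : R).
Hypothesis n_gt0 : (0 < n)%N.
Hypothesis G_martingale :
  forall k r c, 0 < r -> child_mean (G k) r c = G k r c.
Hypothesis G_bound : forall k r c, 0 < r -> `|G k r c| <= L.

(** [C] plays the role of an approximate limit of [G] at x. Cubes count as soon as their dilate
    contains x, which admits all the cubes met by a grid path near x. *)
Definition nontangential K delta r c x : Prop :=
  exists (C : I -> R) (j0 : nat), forall j a, (j0 <= j)%N ->
    subcube j r c a -> dilate K (r / 2 ^+ j) a x ->
    energy G C (r / 2 ^+ j) a <= delta.

Let bad K delta r c := [set x | dilate 0 r c x /\ ~ nontangential K delta r c x].

(** As x is interior to the child, a sufficiently small cube whose dilate contains x lies in the
    child. Generation [j.+1] of the parent is generation j of the child, whence the successor in the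
    threshold. *)
Lemma nontangential_child K delta r c (s : bits) x : 0 <= K -> 0 < r ->
  (forall i, let c' := c + (r / 2) *: bitvec R s in
     c' ord0 i < x ord0 i < c' ord0 i + r / 2) ->
  nontangential K delta (r / 2) (c + (r / 2) *: bitvec R s) x ->
  nontangential K delta r c x.
Proof.
move=> K0 r0 xint [C [j0 Cj0]].
have [J HJ] : exists J, forall j i, (J <= j)%N ->
    let c' := c + (r / 2) *: bitvec R s in
    c' ord0 i < x ord0 i - (K + 1) * r / 2 ^+ j /\
    x ord0 i + (K + 1) * r / 2 ^+ j < c' ord0 i + r / 2.
  have [J _ HJ] : \forall j \near \oo, forall i,
    let c' := c + (r / 2) *: bitvec R s in
    c' ord0 i < x ord0 i - (K + 1) * r / 2 ^+ j /\
    x ord0 i + (K + 1) * r / 2 ^+ j < c' ord0 i + r / 2.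
    apply: filter_forall => i /=.
    have /andP[x1 x2] := xint i.
    have H := cvg_halving ((K + 1) * r).
    move/cvgrPdist_lt : H => H.
    near=> j; split.
      rewrite ltrBrDl -ltrBrDr; apply: le_lt_trans (ler_norm _) _.
      by rewrite -[X in `|X|]opprK normrN -sub0r; near: j; apply: H; rewrite subr_gt0.
    rewrite -ltrBrDl; apply: le_lt_trans (ler_norm _) _.
    by rewrite -[X in `|X|]opprK normrN -sub0r; near: j; apply: H; rewrite subr_gt0.
  by exists J => j i Jj; exact: HJ.
exists C, (maxn J j0).+1 => -[//|j] a; rewrite ltnS geq_max => /andP[Jj j0j] ja.
have h0 : 0 < r / 2 ^+ j.+1 by rewrite divr_gt0// exprn_gt0.
move=> /dilateP xa; rewrite -half_pow; apply: Cj0 => //; last first.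
  by rewrite half_pow; apply/dilateP.
have [z [zlt az]] := subcube_coord ja.
(* The corner [a] is so close to x that it falls in the same child, that is, the leading binary
   digit of [z i] is [s i]. *)
have zs i : (s i * 2 ^ j <= z i < s i * 2 ^ j + 2 ^ j)%N.
  have [] := HJ j.+1 i (leqW Jj); have /andP[] := xa i.
  rewrite az addZmxE [bitvec _ _ _ _]mxE.
  have -> : r / 2 = r / 2 ^+ j.+1 * (2 ^ j)%:R.
    by rewrite natrX exprS; field; rewrite expf_neq0.
  rewrite -(mulrA (K + 1)); move: (r / 2 ^+ j.+1) h0 => h h0 x1 x2 x3 x4.
  apply/andP; split.
    rewrite -(ler_nat R) natrM -(ler_pM2l h0); nra.
  rewrite -(ltr_nat R) natrD natrM -(ltr_pM2l h0); nra.
apply: (@coord_subcube _ _ _ _ (fun i => z i - s i * 2 ^ j)%N) => i.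
  have := zs i; lia.
have /andP[szi _] := zs i.
rewrite az !mxE half_pow exprS natrB// natrM natrX; field.
by rewrite expf_neq0.
Unshelve. all: by end_near. Qed.

(* A point is compared with the cube of generation m that contains it: there C is
   the value of G on that cube, and the variance controls the maximal inequality. *)
Lemma nontangential_outer m K delta r c : 0 <= K -> 0 < delta -> 0 < r ->
  (lebesgue_outer (bad K delta r c) <=
    (((2 * K + 1) * r) ^+ n / delta * iter m (@child_mean R n) (variance G) r c)%:E)%E.
Proof.
move=> K0 d0; elim: m r c => [|m IH] r c r0.
  pose U := energy G (fun k => G k r c).
  rewrite /= mulrAC -mulrA; apply: le_trans (@maximal_inequality K delta U
    n_gt0 K0 d0 _ _ r c r0).
  - apply: le_lebesgue_outer => x [xc nx]; apply: contrapT => nbad; apply: nx.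
    exists (fun k => G k r c), 0%N => j a _ ja xa.
    rewrite leNgt; apply/negP => lt; apply: nbad; by exists j, a.
  - by move=> r' c' r'0; exact: (energy_ge0 G_martingale G_bound).
  - by move=> r' c' r'0; rewrite (energy_martingale G_martingale G_bound).
(* In each direction three hyperplanes bound the children: the two faces of the cube and the one
   midway. A point of the cube off all of them is interior to a child. *)
pose face (p : 'I_n * 'I_3) :=
  [set x : vec | dilate 0 r c x /\ x ord0 p.1 = c ord0 p.1 + (r / 2) * (p.2 : nat)%:R].
pose child (s : bits) := bad K delta (r / 2) (c + (r / 2) *: bitvec R s).
have sub : bad K delta r c `<=` (\bigcup_p face p) `|` (\bigcup_s child s).
  move=> x [xc nx]; have [xf|xf] := pselect ((\bigcup_p face p) x); [by left|right].
  have nf i (k : 'I_3) : x ord0 i != c ord0 i + (r / 2) * (k : nat)%:R.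
    by apply/eqP => e; apply: xf; exists (i, k).
  pose s : bits := [ffun i => c ord0 i + r / 2 < x ord0 i].
  have xint i : let c' := c + (r / 2) *: bitvec R s in
     c' ord0 i < x ord0 i < c' ord0 i + r / 2.
    rewrite /= !mxE ffunE.
    have /dilateP/(_ i) := xc; rewrite mul0r subr0 add0r mul1r => /andP[x1 x2].
    have := nf i (inord 0); have := nf i (inord 1); have := nf i (inord 2).
    rewrite !inordK// mulr0 mulr1 addr0 divfK//.
    move=> x3 x4 x5.
    have x6 : c ord0 i < x ord0 i by rewrite lt_neqAle eq_sym x5.
    have x7 : x ord0 i < c ord0 i + r by rewrite lt_neqAle x3.
    case: (ltP (c ord0 i + r / 2)) => x8; rewrite ?mulr1 ?mulr0 ?addr0.
      by rewrite x8 -addrA -splitr.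
    by rewrite x6 lt_neqAle x4.
  exists s => //; split.
    apply/dilateP => i; have /andP[x1 x2] := xint i.
    by rewrite mul0r subr0 add0r mul1r !ltW.
  by move=> /(nontangential_child K0 r0 xint).
apply: (le_trans (le_lebesgue_outer sub)).
rewrite (le_trans (lebesgue_outerU n_gt0 _ _))//.
rewrite (_ : lebesgue_outer (\bigcup_p face p) = 0%E) ?add0e; last first.
  apply/eqP; rewrite eq_le lebesgue_outer_ge0 andbT.
  rewrite (le_trans (lebesgue_outer_bigcup_fin n_gt0 _))// big1// => p _.
  exact/hyperplane_null/ltW.
rewrite (le_trans (lebesgue_outer_bigcup_fin n_gt0 _))//=.
apply: (@le_trans _ _ (\sum_(s : bits) (((2 * K + 1) * (r / 2)) ^+ n / delta *
  iter m (@child_mean R n) (variance G) (r / 2) (c + (r / 2) *: bitvec R s))%:E)%E).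
  by apply: lee_sum => s _; apply: IH; rewrite divr_gt0.
rewrite sumEFin lee_fin -mulr_sumr {2}/child_mean /sub_mean /mean.
rewrite !exprMn exprVn le_eqVlt; apply/orP; left; apply/eqP; ring.
Qed.

Lemma nontangential_ae K delta r c : 0 <= K -> 0 < delta -> 0 < r ->
  lebesgue_outer (bad K delta r c) = 0%E.
Proof.
move=> K0 d0 r0; apply/eqP; rewrite eq_le lebesgue_outer_ge0 andbT.
pose b := ((2 * K + 1) * r) ^+ n / delta.
have H : (fun m => (b * iter m (@child_mean R n) (variance G) r c)%:E) @ \oo -->
    (b * 0)%:E.
  apply: cvg_EFin; first by apply: nearW.
  apply: cvgM; first exact: cvg_cst.
  exact: (cvg_variance G_martingale G_bound).
rewrite mulr0 in H; rewrite -[leRHS]/(0%:E) -(cvg_lim _ H)//; apply: lime_ge.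
  by apply/cvg_ex; eexists; exact: H.
by apply: nearW => m; exact: nontangential_outer.
Qed.

End Nontangential.
End DyadicCubes.

(** * Affine approximation along grid paths *)

Section GridPaths.
Context (R : realType) (n : nat).
Local Notation vec := 'rV[R]_n.
Implicit Types (r h K : R) (a b c x : vec) (i l : 'I_n) (u z : 'I_n -> int).

Definition gridpt b h u : vec := \row_l (b ord0 l + h * (u l)%:~R).

Lemma gridptD b h u z :
  gridpt (gridpt b h u) h z = gridpt b h (fun l => u l + z l).
Proof. by apply/rowP => l; rewrite !mxE intrD mulrDr addrA. Qed.

(* The points of an axis-parallel grid path from 0 to u; on the i-th run they are
   listed by increasing i-th coordinate, whatever the sign of u i. *)
Definition path_point u i (s : nat) : 'I_n -> int :=
  fun l => if (l < i)%N then u l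
           else if l == i then (if 0 <= u i then 0 else u i) + s%:Z else 0.

Lemma path_point_bounds u i s l : (s < `|u i|)%N ->
  (0 <= path_point u i s l <= u l) || (u l <= path_point u i s l <= 0).
Proof.
rewrite /path_point; case: (ltnP l i) => _ su.
  lia.
case: eqP => [->|_].
  case: ifP; lia.
lia.
Qed.

Lemma path_point_range u z i s l (m : nat) : (s < `|u i|)%N ->
  (0 <= z l < m%:Z) -> (0 <= z l + u l < m%:Z) ->
  (0 <= z l + path_point u i s l < m%:Z).
Proof.
by move=> /(path_point_bounds l); move: (path_point u i s l) => p; lia.
Qed.

Lemma path_point_le u i s l : (s < `|u i|)%N -> `|path_point u i s l| <= `|u l|.
Proof.
by move=> /(path_point_bounds l); move: (path_point u i s l) => p; lia.
Qed.

Lemma gridpt_subcube j r c z : (forall l, 0 <= z l < (2 ^ j)%N%:Z) ->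
  subcube j r c (gridpt c (r / 2 ^+ j) z).
Proof.
move=> zj; apply: (@coord_subcube _ _ _ _ _ _ (fun l => `|z l|%N)) => l.
  by have := zj l; lia.
by rewrite mxE natr_absz ger0_norm//; have /andP[] := zj l.
Qed.

Section Run.
Context (L : R) (phi : vec -> R).
Hypotheses (L_ge0 : 0 <= L) (phi_lip : suplip L phi).

(** A slope times h is a difference of averages over consecutive parallel faces, so the slopes
    telescope along the run; [2 * L * h] pays for replacing the face averages by values of [phi] at
    the two ends. *)
Lemma axis_run i h b (C : R) (m : nat) : 0 < h ->
  `|phi (b + (h * m%:R) *: delta_mx ord0 i) - phi b - h * m%:R * C| <=
  2 * L * h + h * \sum_(s < m)
    `|slope phi i h (b + (h * s%:R) *: delta_mx ord0 i) - C|.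
Proof.
move=> h0; pose p (s : nat) := b + (h * s%:R) *: delta_mx ord0 i : vec.
pose F := face_average phi i h.
have Fphi y : `|F y - phi y| <= L * h.
  rewrite -[X in L * X](gtr0_norm h0).
  exact: (average_near (zero_bit i) L_ge0 phi_lip).
have run : F (p m) - F b - h * m%:R * C =
    h * \sum_(s < m) (slope phi i h (p s) - C).
  rewrite sumrB sumr_const card_ord -(mulr_natl C) mulrBr mulrA; congr (_ - _).
  have -> : F b = F (p 0%N) by rewrite /p mulr0 scale0r addr0.
  rewrite mulr_sumr -(telescope_sumr (fun s => F (p s)) (leq0n m)) big_mkord.
  apply: eq_bigr => s _; rewrite /slope mulrC divfK ?gt_eqF//.
  congr (F _ - _); rewrite /p -addrA -scalerDl; congr (_ + _ *: _).
  by rewrite -natr1 mulrDr mulr1.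
rewrite -/(p m) -[phi (p m)](subKr (F (p m))).
have -> : F (p m) - (F (p m) - phi (p m)) - phi b - h * m%:R * C =
   (F b - phi b) - (F (p m) - phi (p m)) + (F (p m) - F b - h * m%:R * C).
  by ring.
rewrite run (le_trans (ler_normD _ _))// lerD//.
  rewrite (le_trans (ler_normB _ _))//.
  by have := Fphi b; have := Fphi (p m); lra.
by rewrite normrM (gtr0_norm h0) ler_wpM2l ?(ltW h0)// ler_norm_sum.
Qed.

Lemma grid_path h b u (C : 'I_n -> R) : 0 < h ->
  `|phi (gridpt b h u) - phi b - h * \sum_i (u i)%:~R * C i| <=
  \sum_i (2 * L * h + h * \sum_(s < `|u i|%N)
    `|slope phi i h (gridpt b h (path_point u i s)) - C i|).
Proof.
(* The points [p k] are the corners of the path, with the first k coordinates already moved; the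
   increment of [phi] is split over the n runs between them. *)
move=> h0; pose w (k : nat) : 'I_n -> int := fun l => if (l < k)%N then u l else 0.
pose p k := gridpt b h (w k).
have -> : gridpt b h u = p n.
  by apply/rowP => l; rewrite !mxE /w ltn_ord.
have -> : phi b = phi (p 0%N).
  by congr phi; apply/rowP => l; rewrite !mxE /w ltn0 mulr0 addr0.
rewrite -(telescope_sumr (fun k => phi (p k)) (leq0n n)) big_mkord mulr_sumr -sumrB.
rewrite (le_trans (ler_norm_sum _ _ _))//; apply: ler_sum => i _.
have pS : p i.+1 = p i + (h * (u i)%:~R) *: delta_mx ord0 i.
  apply/rowP => l; rewrite !mxE /w ltnS leq_eqVlt eqxx/= -val_eqE/=.
  case: ltngtP => /= [_|_|/val_inj ->]; rewrite ?mulr0 ?addr0//.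
  by rewrite mulr1.
have pp (s : nat) : gridpt b h (path_point u i s) =
    gridpt b h (fun l => if (l < i)%N then u l
      else if l == i then (if 0 <= u i then 0 else u i) else 0) + (h * s%:R) *: delta_mx ord0 i.
  apply/rowP => l; rewrite !mxE /path_point eqxx/=.
  case: ltngtP => /= [li|il|/val_inj ->].
  - by rewrite -val_eqE/= (ltn_eqF li) mulr0 addr0.
  - by rewrite -val_eqE/= (gtn_eqF il) !mulr0 !addr0.
  - by rewrite eqxx intrD mulrDr mulr1 addrA.
have [ui|ui] := leP 0 (u i).
  have := @axis_run i h (p i) (C i) `|u i| h0.
  rewrite pmulrn gez0_abs// -pS -[h * _ * C i]mulrA => H.
  apply: le_trans H _; rewrite lerD2l ler_wpM2l ?(ltW h0)//.
  apply: ler_sum => s _; rewrite pp; rewrite (_ : gridpt _ _ _ = p i)//.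
  apply/rowP => l; rewrite !mxE /w; case: ltnP => // _; case: eqP => // _.
  by rewrite ui.
(* For negative [u i] the run is read backwards, from its end [p i.+1], which is the order in which
   [path_point] lists it. *)
have := @axis_run i h (p i.+1) (C i) `|u i| h0.
have -> : p i.+1 + (h * `|u i|%:R) *: delta_mx ord0 i = p i.
  rewrite pS -addrA -scalerDl -mulrDr pmulrn ltz0_abs// mulrNz subrr mulr0 scale0r.
  by rewrite addr0.
rewrite pmulrn ltz0_abs// mulrNz => H.
rewrite -normrN; apply: le_trans (le_trans H _).
  by rewrite le_eqVlt; apply/orP; left; apply/eqP; congr `|_|; ring.
rewrite lerD2l ler_wpM2l ?(ltW h0)//.
apply: ler_sum => s _; rewrite pp; rewrite (_ : gridpt _ _ _ = p i.+1)//.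
apply/rowP => l; rewrite !mxE /w ltnS.
have [li|il|/val_inj ->] := ltngtP l i; last by rewrite eqxx leNgt ui.
  by [].
by rewrite -val_eqE/= (gtn_eqF il).
Qed.

End Run.

Lemma sum_ord_cst (m : nat) (e : R) : \sum_(i < m) e = m%:R * e.
Proof. by rewrite sumr_const card_ord mulr_natl. Qed.

Lemma fin_lower_bound (I : finType) (F : I -> R) : (forall k, 0 < F k) ->
  exists2 m : R, 0 < m & forall k, m <= F k.
Proof.
move=> F0; exists (\big[Num.min/1]_k F k).
  by apply: lt_bigmin => // k _; exact: F0.
by move=> k; exact: bigmin_le_cond.
Qed.

(** The first generation of side at most [e] works: the previous side exceeds [e], which gives the
    lower bound. *)
Lemma ex_scale (r e : R) (j0 : nat) : 0 < e -> e < r / 2 ^+ j0 ->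
  exists2 j, (j0 <= j)%N & e / 2 < r / 2 ^+ j <= e.
Proof.
move=> e0 ej0; have ex : exists j, r / 2 ^+ j <= e.
  have /cvgrPdist_lt/(_ _ e0)[J _ /(_ J (leqnn J))] := cvg_halving r.
  by rewrite sub0r normrN => /ltW /(le_trans (ler_norm _)); exists J.
have r0 : 0 < r.
  by have := lt_trans e0 ej0; rewrite pmulr_lgt0// invr_gt0 exprn_gt0.
have antitone (k l : nat) : (k <= l)%N -> r / 2 ^+ l <= r / 2 ^+ k.
  move=> kl; rewrite ler_pM2l// lef_pV2 ?posrE ?exprn_gt0//.
  by rewrite ler_weXn2l// ler1n.
case: (ex_minnP ex) => j rj jmin.
have j0j : (j0 < j)%N.
  by rewrite ltnNge; apply/negP => /antitone; apply/negP; rewrite -ltNge (le_lt_trans rj).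
exists j; first exact: ltnW.
rewrite rj andbT; case: j rj jmin j0j => // j _ jmin _.
have : e < r / 2 ^+ j.
  by rewrite ltNge; apply/negP => /jmin; rewrite ltnn.
by rewrite -half_pow mulrAC ltr_pM2r.
Qed.

(** * Small energy forces affine approximation *)

Section AffineApproximation.
Context (L : R) (f : vec -> vec).
Hypothesis L_ge0 : 0 <= L.
Hypothesis f_lip : forall l, suplip L (fun x => f x ord0 l).

(* k is a pair (direction of derivation, component of f). *)
Definition gradient (k : 'I_n * 'I_n) : R -> vec -> R :=
  slope (fun x => f x ord0 k.2) k.1.

Lemma sqdist_gradient (C : 'I_n * 'I_n -> R) (kappa : R) r a k : 0 <= kappa ->
  sqdist gradient C r a <= kappa ^+ 2 -> `|gradient k r a - C k| <= kappa.
Proof.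
move=> k0 H; rewrite -[leRHS]ger0_norm// -ler_sqr ?nnegrE// !real_normK ?num_real//.
apply: le_trans H; rewrite /sqdist (bigD1 k)//= lerDl.
by apply: sumr_ge0 => j _; rewrite sqr_ge0.
Qed.

Lemma gradient_martingale k r c : 0 < r ->
  child_mean (gradient k) r c = gradient k r c.
Proof. exact: (slope_martingale L_ge0 (f_lip _)). Qed.

Lemma gradient_bound k r c : 0 < r -> `|gradient k r c| <= L.
Proof. exact: (slope_bound L_ge0 (f_lip _)). Qed.

(** A displacement of size rho is followed on a grid of mesh h between rho / N and 2 rho / N. A run
    has at most N + 1 steps, each with a gradient within 1 / (N + 2) of [C], so every error is a
    multiple of h. The cubes on the path are at most N + 1 steps away from that of x, hence the
    dilation factor. *)
Lemma affine_approximation (N : R) r c x (C : 'I_n * 'I_n -> R) (j0 : nat) :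
  0 < N -> 0 < r -> (forall i, c ord0 i < x ord0 i < c ord0 i + r) ->
  (forall j a, (j0 <= j)%N -> subcube j r c a ->
    dilate (N + 1) (r / 2 ^+ j) a x ->
    energy gradient C (r / 2 ^+ j) a <= (N + 2)^-1 ^+ 2) ->
  exists2 rho0 : R, 0 < rho0 & forall (rho : R) (d : vec) l, 0 < rho < rho0 ->
    (forall i, `|d ord0 i| <= rho) ->
    `|f (x + d) ord0 l - f x ord0 l - \sum_i d ord0 i * C (i, l)| <=
      2 / N * (n%:R * (3 * L + 2) + 2 * L) * rho.
Proof.
move=> N0 r0 xc Cj0.
have [m m0 xm] : exists2 m, 0 < m & forall i,
    c ord0 i + m <= x ord0 i /\ x ord0 i + m <= c ord0 i + r.
  have [|m m0 mP] := @fin_lower_bound 'I_n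
      (fun i => Num.min (x ord0 i - c ord0 i) (c ord0 i + r - x ord0 i)).
    by move=> i; rewrite lt_min !subr_gt0.
  exists m => // i; have := mP i; rewrite le_min => /andP[]; lra.
(* The first bound keeps [x + d] inside the cube; the second makes the mesh fine enough to belong to
   a generation from [j0] on. *)
exists (Num.min m (N / 2 * (r / 2 ^+ j0))).
  by rewrite lt_min m0/= !mulr_gt0 ?invr_gt0 ?exprn_gt0.
move=> rho d l /andP[rho0]; rewrite lt_min => /andP[rhom rhoj0] drho.
have e0 : 0 < 2 / N * rho by rewrite !mulr_gt0 ?invr_gt0.
have [|j j0j /andP[]] := @ex_scale r _ j0 e0.
  rewrite -ltr_pdivlMl ?mulr_gt0 ?invr_gt0// (lt_le_trans rhoj0)//.
  by rewrite invf_div.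
set h := r / 2 ^+ j => hlo hhi.
have h0 : 0 < h by rewrite divr_gt0 ?exprn_gt0.
have rhoh : rho <= N * h.
  rewrite -ler_pdivrMl//; apply: ltW; apply: le_lt_trans hlo.
  by rewrite le_eqVlt; apply/orP; left; apply/eqP; field; rewrite gt_eqF.
pose y := x + d; pose fl (v : vec) i := Num.floor ((v ord0 i - c ord0 i) / h).
have flP v i : (fl v i)%:~R * h <= v ord0 i - c ord0 i < (fl v i)%:~R * h + h.
  have /andP[v1 v2] := floor_itv ((v ord0 i - c ord0 i) / h).
  rewrite -ler_pdivlMr// v1/=; move: v2; rewrite ltr_pdivrMr//.
  by rewrite intrD mulrDl mul1r.
have yi i : `|y ord0 i - x ord0 i| <= rho.
  by rewrite /y mxE addrC addKr.
pose u i := fl y i - fl x i.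
pose a := gridpt c h (fl x).
have hu i : h * (u i)%:~R = (fl y i)%:~R * h - (fl x i)%:~R * h.
  by rewrite /u intrB mulrBr !(mulrC h).
have uN i : `|(u i)%:~R : R| <= N + 1.
  rewrite -(ler_pM2l h0) -{1}(gtr0_norm h0) -normrM hu.
  by have := flP x i; have := flP y i; have := yi i; rewrite !ler_norml; nra.
have in_cube (v : vec) i : `|v ord0 i - x ord0 i| <= rho ->
    (0 <= fl v i < (2 ^ j)%N%:Z)%R.
  move=> vx; have [x1 x2] := xm i; have := vx; rewrite ler_norml => /andP[v1 v2].
  have /andP[v3 v4] := flP v i.
  have r2 : r = h * ((2 ^ j)%N%:Z)%:~R by rewrite -pmulrn natrX divfK// expf_neq0.
  apply/andP; split.
    rewrite -ltzD1 -(ltr0z R) intrD -(pmulr_rgt0 _ h0).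
    by rewrite mulrDr mulr1 mulrC; lra.
  by rewrite -(ltr_int R) -(ltr_pM2l h0) -r2 mulrC; lra.
have path_energy i s : (s < `|u i|)%N ->
    `|gradient (i, l) h (gridpt a h (path_point u i s)) - C (i, l)| <= (N + 2)^-1.
  move=> su; apply: sqdist_gradient; first by rewrite invr_ge0; lra.
  have := energy_ge gradient_martingale gradient_bound C
    (gridpt a h (path_point u i s)) 0 h0.
  move=> /= /le_trans; apply; apply: Cj0 => //.
    rewrite gridptD; apply: gridpt_subcube => k; apply: path_point_range su _ _.
      by apply: in_cube; rewrite subrr normr0 ltW.
    by rewrite /u addrC subrK; exact: in_cube.
  rewrite -/h gridptD; apply/dilateP => k; rewrite mxE intrD mulrDr.
  have pN : `|(path_point u i s k)%:~R : R| <= N + 1.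
    apply: le_trans (uN k); rewrite -!intr_norm ler_int.
    exact: path_point_le.
  have := flP x k; move: pN; rewrite ler_norml => /andP[]; nra.
have CL i : `|C (i, l)| <= L + (N + 2)^-1.
  rewrite -(subKr (gradient (i, l) h a) (C (i, l))).
  rewrite (le_trans (ler_normB _ _))// lerD ?gradient_bound//.
  apply: sqdist_gradient; first by rewrite invr_ge0; lra.
  have := energy_ge gradient_martingale gradient_bound C a 0 h0.
  move=> /= /le_trans; apply; apply: Cj0 => //.
    by apply: gridpt_subcube => k; apply: in_cube; rewrite subrr normr0 ltW.
  by apply/dilateP => k; rewrite mxE -/h; have := flP x k; nra.
have near_grid v : `|f v ord0 l - f (gridpt c h (fl v)) ord0 l| <= L * h.
  apply: f_lip; first exact: ltW.
  by move=> i; rewrite mxE; have := flP v i; rewrite ler_norml; lra.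
have ya : gridpt a h u = gridpt c h (fl y).
  by rewrite gridptD; congr gridpt; apply/funext => i; rewrite /u addrC subrK.
have main := @grid_path _ _ L_ge0 (f_lip l) h a u (fun i => C (i, l)) h0.
have {}main : `|f (gridpt c h (fl y)) ord0 l - f a ord0 l -
    h * \sum_i (u i)%:~R * C (i, l)| <= n%:R * (h * (2 * L + 1)).
  rewrite -ya; apply: le_trans main _.
  rewrite -[leRHS]sum_ord_cst; apply: ler_sum => i _.
  have : \sum_(s < `|u i|%N)
      `|slope (fun v => f v ord0 l) i h (gridpt a h (path_point u i s)) - C (i, l)| <= 1.
    apply: (@le_trans _ _ (\sum_(s < `|u i|%N) (N + 2)^-1)).
      by apply: ler_sum => s _; exact: path_energy.
    rewrite sum_ord_cst ler_pdivrMr ?mul1r; last by lra.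
    by have := uN i; rewrite natr_absz intr_norm; lra.
  by move: (\sum_(s < _) _) => S; nra.
have N2 : (N + 2)^-1 <= 1 by rewrite invf_le1; lra.
have rest : `|\sum_i (d ord0 i - h * (u i)%:~R) * C (i, l)| <=
    n%:R * (h * (L + 1)).
  rewrite -[leRHS]sum_ord_cst.
  rewrite (le_trans (ler_norm_sum _ _ _))//; apply: ler_sum => i _.
  rewrite normrM ler_pM//; last by rewrite (le_trans (CL i))// lerD2l.
  rewrite hu; have := flP x i; have := flP y i; rewrite /y mxE ler_norml; lra.
(* The error splits into the rounding of [x + d] and of x to the grid, the error along the path, and
   the rounding of [d] to [h u]. *)
have -> : f (x + d) ord0 l - f x ord0 l - \sum_i d ord0 i * C (i, l) =
    (f y ord0 l - f (gridpt c h (fl y)) ord0 l) - (f x ord0 l - f a ord0 l) +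
    (f (gridpt c h (fl y)) ord0 l - f a ord0 l -
      h * \sum_i (u i)%:~R * C (i, l)) -
    \sum_i (d ord0 i - h * (u i)%:~R) * C (i, l).
  have -> : \sum_i (d ord0 i - h * (u i)%:~R) * C (i, l) =
      \sum_i d ord0 i * C (i, l) - h * \sum_i (u i)%:~R * C (i, l).
    by rewrite mulr_sumr -sumrB; apply: eq_bigr => i _; rewrite mulrBl mulrA.
  by rewrite /y; ring.
rewrite (le_trans (ler_normB _ _))//.
apply: (@le_trans _ _ (L * h + L * h + n%:R * (h * (2 * L + 1)) + n%:R * (h * (L + 1)))).
  rewrite lerD// (le_trans (ler_normD _ _))// lerD//.
  by rewrite (le_trans (ler_normB _ _))// lerD ?near_grid.
rewrite [leRHS]mulrAC; set b := n%:R * _ + _.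
apply: (@le_trans _ _ (h * b)); last first.
  by rewrite ler_wpM2r// /b addr_ge0 ?mulr_ge0// addr_ge0// mulr_ge0.
by rewrite le_eqVlt; apply/orP; left; apply/eqP; rewrite /b; ring.
Qed.

End AffineApproximation.
End GridPaths.

(** * Euclidean norm and length of curves *)

Section EuclideanNorm.
Context (R : realType) (n : nat).
Local Notation vec := 'rV[R]_n.
Implicit Types (x y z : vec).

Lemma enorm_ge0 x : 0 <= enorm x.
Proof. exact: sqrtr_ge0. Qed.

Lemma sqr_enorm x : enorm x ^+ 2 = \sum_(i < n) x ord0 i ^+ 2.
Proof. by rewrite sqr_sqrtr//; apply: sumr_ge0 => i _; rewrite sqr_ge0. Qed.

Lemma enormZ (t : R) x : enorm (t *: x) = `|t| * enorm x.
Proof.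
rewrite /enorm -sqrtr_sqr -sqrtrM ?sqr_ge0// mulr_sumr.
by congr Num.sqrt; apply: eq_bigr => i _; rewrite mxE exprMn.
Qed.

Lemma enormN x : enorm (- x) = enorm x.
Proof. by rewrite -scaleN1r enormZ normrN1 mul1r. Qed.

Lemma enormB x y : enorm (x - y) = enorm (y - x).
Proof. by rewrite -opprB enormN. Qed.

Lemma enorm0 : enorm (0 : vec) = 0.
Proof. by rewrite -(scale0r 0) enormZ normr0 mul0r. Qed.

Lemma coord_le_enorm x i : `|x ord0 i| <= enorm x.
Proof.
rewrite -sqrtr_sqr ler_wsqrtr// (bigD1 i)//= lerDl.
by apply: sumr_ge0 => j _; rewrite sqr_ge0.
Qed.

(** Lagrange's identity: twice the difference of the two sides is a double sum of squares. *)
Lemma cauchy_schwarz_sum (u v : 'I_n -> R) :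
  (\sum_i u i * v i) ^+ 2 <= (\sum_i u i ^+ 2) * (\sum_i v i ^+ 2).
Proof.
have : 0 <= \sum_i \sum_j (u i * v j - u j * v i) ^+ 2.
  by apply: sumr_ge0 => i _; apply: sumr_ge0 => j _; rewrite sqr_ge0.
have -> : \sum_i \sum_j (u i * v j - u j * v i) ^+ 2 =
    2 * ((\sum_i u i ^+ 2) * (\sum_i v i ^+ 2)) - 2 * (\sum_i u i * v i) ^+ 2.
  set A := \sum_i u i ^+ 2; set B := \sum_i v i ^+ 2; set D := \sum_i u i * v i.
  transitivity (\sum_i (u i ^+ 2 * B + v i ^+ 2 * A + (-2) * (u i * v i * D))).
    apply: eq_bigr => i _; rewrite !mulr_sumr -!big_split /=.
    by apply: eq_bigr => j _; ring.
  by rewrite !big_split /= -mulr_sumr -!mulr_suml -/A -/B -/D; ring.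
by lra.
Qed.

Lemma ler_enormD x y : enorm (x + y) <= enorm x + enorm y.
Proof.
rewrite -ler_sqr ?nnegrE ?addr_ge0 ?enorm_ge0// sqrrD !sqr_enorm.
have -> : \sum_(i < n) (x + y) ord0 i ^+ 2 = \sum_(i < n) x ord0 i ^+ 2 +
    (\sum_(i < n) x ord0 i * y ord0 i) *+ 2 + \sum_(i < n) y ord0 i ^+ 2.
  rewrite -sumrMnl -!big_split/=.
  by apply: eq_bigr => i _; rewrite mxE sqrrD.
rewrite lerD2r lerD2l lerMn2r/=.
rewrite (le_trans (ler_norm _))// -ler_sqr ?nnegrE ?mulr_ge0 ?enorm_ge0//.
by rewrite real_normK ?num_real// exprMn !sqr_enorm cauchy_schwarz_sum.
Qed.

Lemma ler_enorm_triangle y x z : enorm (x - z) <= enorm (x - y) + enorm (y - z).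
Proof. by rewrite -(subrKA y) ler_enormD. Qed.

Lemma ler_enorm_sum (m : nat) (g : nat -> vec) (k : nat) : (k <= m)%N ->
  enorm (g m - g k) <= \sum_(k <= i < m) enorm (g i.+1 - g i).
Proof.
elim: m => [|m IH]; first by rewrite leqn0 => /eqP ->; rewrite subrr enorm0 big_geq.
rewrite leq_eqVlt ltnS => /predU1P[->|km]; first by rewrite subrr enorm0 big_geq.
rewrite big_nat_recr//= addrC (le_trans (ler_enorm_triangle (g m) _ _))//.
by rewrite lerD2l IH.
Qed.

Lemma enorm_le_sum x : enorm x <= \sum_(i < n) `|x ord0 i|.
Proof.
have x0 : 0 <= \sum_(i < n) `|x ord0 i| by apply: sumr_ge0.
rewrite -ler_sqr ?nnegrE ?enorm_ge0// sqr_enorm expr2 mulr_suml.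
apply: ler_sum => i _; rewrite -real_normK ?num_real// expr2 ler_wpM2l//.
by rewrite (bigD1 i)//= lerDl sumr_ge0.
Qed.

Lemma enorm_le_sup x (rho : R) :
  (forall i, `|x ord0 i| <= rho) -> enorm x <= n%:R * rho.
Proof.
move=> xrho; rewrite -sum_ord_cst (le_trans (enorm_le_sum x))//.
by apply: ler_sum => i _; exact: xrho.
Qed.

End EuclideanNorm.

(** * Length of Lipschitz curves at dyadic resolution *)

Section CurveLength.
Context (R : realType) (n : nat).
Local Notation vec := 'rV[R]_n.
Implicit Types (g : R -> vec).

Definition dyadic_length (N : nat) g : R :=
  \sum_(0 <= k < 2 ^ N) enorm (g (k.+1%:R / 2 ^+ N) - g (k%:R / 2 ^+ N)).

Lemma dyadic_length_leS N g : dyadic_length N g <= dyadic_length N.+1 g.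
Proof.
rewrite /dyadic_length expnS.
have dbl (F : nat -> R) m :
    \sum_(0 <= k < 2 * m) F k = \sum_(0 <= k < m) (F (2 * k)%N + F (2 * k).+1).
  elim: m => [|m IH]; first by rewrite muln0 !big_geq.
  by rewrite mulnS !addSn add0n !big_nat_recr//= IH addrA.
rewrite dbl; apply: ler_sum => k _.
have half (j : nat) : j%:R / 2 ^+ N = (2 * j)%:R / 2 ^+ N.+1 :> R.
  by rewrite natrM exprS; field; rewrite expf_neq0.
rewrite (half k) (half k.+1) [leRHS]addrC (_ : (2 * k.+1 = (2 * k).+2)%N); last by lia.
exact: ler_enorm_triangle.
Qed.

Lemma dyadic_length_le N N' g : (N <= N')%N ->
  dyadic_length N g <= dyadic_length N' g.
Proof.
move/subnK => <-; elim: (N' - N)%N => [//|k IH].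
by rewrite addSn (le_trans IH)// dyadic_length_leS.
Qed.

Lemma nth_itv_partition (a b : R) s i : itv_partition a b s ->
  (i < size s)%N -> nth b (a :: s) i < nth b (a :: s) i.+1.
Proof. by move=> [/(pathP b) H _] /H. Qed.

(* Rounding down to multiples of 2^-N turns the length along a partition into a
   telescoping sum of increments of t |-> \sum_(k < 2^N t) d_k. *)
Lemma polygonal_length_dyadic N g (Lam : R) s : 0 <= Lam ->
  (forall t u, enorm (g t - g u) <= Lam * `|t - u|) ->
  itv_partition 0 1 s ->
  polygonal_length 0 1 g s <=
    dyadic_length N g + (size s)%:R * (2 * Lam / 2 ^+ N).
Proof.
move=> Lam0 glip sp; have N0 : 0 < 2 ^+ N :> R by rewrite exprn_gt0.
pose d k := enorm (g (k.+1%:R / 2 ^+ N) - g (k%:R / 2 ^+ N)).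
pose m (t : R) := Num.truncn (t * 2 ^+ N).
pose psi t := \sum_(0 <= k < m t) d k.
have mP t : 0 <= t -> (m t)%:R / 2 ^+ N <= t < (m t)%:R / 2 ^+ N + 1 / 2 ^+ N.
  move=> t0; have /andP[] := truncn_itv (mulr_ge0 t0 (ltW N0)).
  by rewrite -mulrDl ler_pdivrMr// ltr_pdivlMr// natr1 => -> ->.
have step t u : 0 <= t -> t <= u ->
    enorm (g u - g t) <= psi u - psi t + 2 * Lam / 2 ^+ N.
  move=> t0 tu; have u0 := le_trans t0 tu.
  have round v : 0 <= v -> enorm (g v - g ((m v)%:R / 2 ^+ N)) <= Lam / 2 ^+ N.
    move=> v0; rewrite (le_trans (glip _ _))// ler_wpM2l//.
    by rewrite ger0_norm; have := mP v v0; lra.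
  have mtu : (m t <= m u)%N by rewrite le_truncn// ler_pM2r.
  have -> : psi u - psi t = \sum_(m t <= k < m u) d k.
    by rewrite /psi (@big_cat_nat _ _ _ (m t) 0 (m u))//= addrAC subrr add0r.
  have H := ler_enorm_sum (fun k => g (k%:R / 2 ^+ N)) mtu.
  have H1 := ler_enorm_triangle (g ((m u)%:R / 2 ^+ N)) (g u) (g t).
  have H2 := ler_enorm_triangle (g ((m t)%:R / 2 ^+ N)) (g ((m u)%:R / 2 ^+ N)) (g t).
  have := round u u0; have := round t t0.
  rewrite (enormB (g t)); rewrite /d; lra.
have nth_ge0 i : (i <= size s)%N -> 0 <= nth 1 (0 :: s) i.
  by move=> si; apply: (itv_partition_nth_ge _ sp).
rewrite /polygonal_length /=.
apply: (@le_trans _ _ (\sum_(0 <= i < size s)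
    (psi (nth 1 (0 :: s) i.+1) - psi (nth 1 (0 :: s) i) + 2 * Lam / 2 ^+ N))).
  rewrite !big_nat; apply: ler_sum => i /= si.
  by apply: step; [exact/nth_ge0/ltnW|exact/ltW/nth_itv_partition].
rewrite big_split/= [X in _ + X <= _]big_mkord sum_ord_cst lerD2r.
rewrite (telescope_sumr (fun i => psi (nth 1 (0 :: s) i)))//.
rewrite (itv_partition_nth_size _ sp) /= {2}/psi /m mul0r truncn0.
rewrite [X in _ - X]big_geq// subr0 /psi /m mul1r -natrX natrK.
by [].
Qed.

(** For a fixed partition the rounding error of [polygonal_length_dyadic] vanishes as N grows. *)
Lemma curve_length_dyadic g (Lam B : R) : 0 <= Lam ->
  (forall t u, enorm (g t - g u) <= Lam * `|t - u|) ->
  (forall N, dyadic_length N g <= B) ->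
  (curve_length 0 1 g <= B%:E)%E.
Proof.
move=> Lam0 glip gB; apply: ge_ereal_sup => _ [s sp <-]; rewrite lee_fin.
have H : (fun N => B + (size s)%:R * (2 * Lam / 2 ^+ N)) @ \oo --> B + (size s)%:R * 0.
  apply: cvgD; first exact: cvg_cst.
  by apply: cvgM; [exact: cvg_cst|exact: cvg_halving].
rewrite mulr0 addr0 in H; rewrite -(cvg_lim _ H)//; apply: limr_ge.
  by apply/cvg_ex; eexists; exact: H.
apply: nearW => N; rewrite (le_trans (polygonal_length_dyadic N Lam0 glip sp))//.
by rewrite lerD2r.
Qed.

Lemma curve_length_ge (a b : R) g : a <= b ->
  ((enorm (g b - g a))%:E <= curve_length a b g)%E.
Proof.
rewrite le_eqVlt => /predU1P[<-|ab].
  rewrite subrr enorm0; apply: ereal_sup_ubound; exists [::] => //.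
  by rewrite /polygonal_length/= big_geq.
apply: ereal_sup_ubound; exists [:: b]; first exact: itv_partition1.
by rewrite /polygonal_length big_nat1.
Qed.

Lemma curve_length_lipschitz g (Lam : R) : 
  (forall t u, enorm (g t - g u) <= Lam * `|t - u|) ->
  (curve_length 0 1 g <= Lam%:E)%E.
Proof.
move=> glip; apply: ge_ereal_sup => _ [s sp <-]; rewrite lee_fin.
rewrite /polygonal_length; apply: (@le_trans _ _ (\sum_(0 <= i < size s)
   Lam * (nth 1 (0 :: s) i.+1 - nth 1 (0 :: s) i))).
  rewrite !big_nat; apply: ler_sum => i /= si; rewrite (le_trans (glip _ _))//.
  by rewrite ger0_norm// subr_ge0 ltW// nth_itv_partition.
rewrite -mulr_sumr (telescope_sumr (fun i => nth 1 (0 :: s) i))//.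
by rewrite (itv_partition_nth_size _ sp)/= subr0 mulr1.
Qed.

End CurveLength.

(** * Segments with short images *)

Section GridSums.
Context (R : realType) (n : nat).
Local Notation vec := 'rV[R]_n.
Local Notation bits := {ffun 'I_n -> bool}.
Local Notation grid m := {ffun 'I_n -> 'I_m}.
Implicit Types (r h : R) (a b : vec) (Phi : R -> vec -> R).

Fact refine_grid_subproof N (s : bits) (z : grid (2 ^ N)%N) i :
  (z i + s i * 2 ^ N < 2 ^ N.+1)%N.
Proof. by have := ltn_ord (z i); rewrite expnS; case: (s i) => /=; lia. Qed.

Definition refine_grid N (sz : bits * grid (2 ^ N)%N) : grid (2 ^ N.+1)%N :=
  [ffun i => Ordinal (refine_grid_subproof sz.1 sz.2 i)].

Lemma refine_grid_bij N : bijective (@refine_grid N).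
Proof.
apply: inj_card_bij => [[s z] [s' z'] /ffunP E|].
  have {}E i : (z i + s i * 2 ^ N = z' i + s' i * 2 ^ N)%N.
    by have := E i; rewrite !ffunE => /(congr1 val).
  have ss' i : s i = s' i.
    have := E i; have := ltn_ord (z i); have := ltn_ord (z' i).
    by case: (s i); case: (s' i) => //=; lia.
  congr pair; apply/ffunP => i; first exact: ss'.
  by have := E i; rewrite ss' => /addIn/val_inj.
rewrite card_prod !card_ffun !card_ord card_bool -expnMn.
by rewrite expnS.
Qed.

Definition natpt m (z : grid m) : 'I_n -> int := fun i => (z i : nat)%:Z.

Lemma sum_grid N Phi r a :
  \sum_(z : grid (2 ^ N)%N) Phi (r / 2 ^+ N) (gridpt a (r / 2 ^+ N) (natpt z)) =
  (2 ^+ n) ^+ N * iter N (@child_mean R n) Phi r a.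
Proof.
elim: N r a => [|N IH] r a.
  rewrite expr0 mul1r divr1 (big_pred1 [ffun=> ord0]) => [|z]; last first.
    by apply/esym/eqP/ffunP => i; rewrite ffunE (ord1 (z i)).
  congr Phi; apply/rowP => i; rewrite mxE /natpt ffunE /=.
  by rewrite mulr0 addr0.
rewrite (reindex (@refine_grid N)); last exact/onW_bij/refine_grid_bij.
rewrite -(pair_big xpredT xpredT (fun s z => Phi (r / 2 ^+ N.+1)
  (gridpt a (r / 2 ^+ N.+1) (natpt (@refine_grid N (s, z))))))/=.
rewrite {1}/child_mean /sub_mean /mean [(2 ^+ n) ^+ N.+1]exprSr -mulrA.
rewrite mulVKf ?expf_neq0//.
rewrite mulr_sumr; apply: eq_bigr => s _; rewrite -IH half_pow.
apply: eq_bigr => z _; congr (Phi _ _); apply/rowP => i.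
rewrite !mxE /natpt ffunE /= -!pmulrn natrD natrM natrX exprS; field.
by rewrite expf_neq0.
Qed.

(** The block of indices from Q to 2 Q, shifted by at most Q, stays in the grid with 4 Q points per
    side; since [Phi] is nonnegative, the block sum is at most the sum over the whole grid. *)
Lemma sum_shifted_grid (Q N : nat) Phi r a (w : 'I_n -> int) :
  (2 ^ N = 4 * Q)%N -> 0 < r -> (forall r a, 0 < r -> 0 <= Phi r a) ->
  (forall i, `|w i| <= Q%:Z) ->
  \sum_(y : grid Q) Phi (r / 2 ^+ N)
    (gridpt a (r / 2 ^+ N) (fun i => natpt y i + Q%:Z + w i)) <=
  (2 ^+ n) ^+ N * iter N (@child_mean R n) Phi r a.
Proof.
move=> NQ r0 Phi0 wQ.
have lt (y : grid Q) i : (absz (natpt y i + Q%:Z + w i)%R < 2 ^ N)%N.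
  by rewrite NQ /natpt; have := wQ i; have := ltn_ord (y i); lia.
pose tr (y : grid Q) : grid (2 ^ N)%N := [ffun i => Ordinal (lt y i)].
have trE y : (fun i => natpt y i + Q%:Z + w i) = natpt (tr y).
  apply/funext => i; rewrite {2}/natpt ffunE/= gez0_abs// /natpt.
  by have := wQ i; lia.
have tr_inj : injective tr.
  move=> y y' E; apply/ffunP => i; apply/val_inj => /=.
  have := congr1 (fun z => natpt z i) E; rewrite -!trE /natpt; lia.
rewrite -sum_grid; under eq_bigr do rewrite trE.
rewrite [leRHS](bigID (fun z => z \in [set tr y | y in [set: grid Q]]%SET))/=.
rewrite big_imset/=; last by move=> y y' _ _; exact: tr_inj.
under [X in _ <= X + _]eq_bigl do rewrite finset.in_setT.
rewrite lerDl; apply: sumr_ge0 => z _; apply: Phi0.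
by rewrite divr_gt0// exprn_gt0.
Qed.

End GridSums.

(** * Integer directions in a cube of small energy *)

Section LowerBound.
Context (R : realType) (n : nat).
Local Notation vec := 'rV[R]_n.
Local Notation grid m := {ffun 'I_n -> 'I_m}.
Context (L : R) (f : vec -> vec).
Hypothesis L_ge0 : 0 <= L.
Hypothesis f_lip : forall l, suplip L (fun x => f x ord0 l).
Context (r : R) (a : vec) (C : 'I_n * 'I_n -> R) (kappa : R).
Hypotheses (r_gt0 : 0 < r) (kappa_gt0 : 0 < kappa).
Hypothesis energy_small : energy (gradient f) C r a <= kappa ^+ 2.

Let start (Q : nat) (y : grid Q) (w : 'I_n -> int) : 'I_n -> int :=
  fun i => natpt y i + Q%:Z + w i.

Lemma start_bounds (Q : nat) (y : grid Q) (w : 'I_n -> int) i :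
  `|w i| <= Q%:Z -> 0 <= start y w i <= (4 * Q)%N%:Z.
Proof. by rewrite /start /natpt; have := ltn_ord (y i); lia. Qed.

(* AM-GM: |t| <= kappa / 2 + t ^ 2 / (2 kappa), and the start points form a
   fraction 4 ^- n of the grid. *)
Lemma sum_gradient_deviation (Q N : nat) (w : 'I_n -> int) k :
  (2 ^ N = 4 * Q)%N -> (forall i, `|w i| <= Q%:Z) ->
  \sum_(y : grid Q)
    `|gradient f k (r / 2 ^+ N) (gridpt a (r / 2 ^+ N) (start y w)) - C k| <=
  (Q ^ n)%:R * (kappa * (1 + 4 ^+ n) / 2).
Proof.
move=> NQ wQ; set h := r / 2 ^+ N.
pose D (y : grid Q) := `|gradient f k h (gridpt a h (start y w)) - C k|.
have DE y : D y <= kappa / 2 + (2 * kappa)^-1 *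
    sqdist (gradient f) C h (gridpt a h (start y w)).
  apply: (@le_trans _ _ (kappa / 2 + (2 * kappa)^-1 * D y ^+ 2)).
    rewrite -subr_ge0.
    have -> : kappa / 2 + (2 * kappa)^-1 * D y ^+ 2 - D y =
        (2 * kappa)^-1 * (D y - kappa) ^+ 2.
      by field; rewrite gt_eqF.
    by rewrite mulr_ge0 ?sqr_ge0// invr_ge0 mulr_ge0// ltW.
  rewrite lerD2l ler_wpM2l//; first by rewrite invr_ge0 mulr_ge0// ltW.
  rewrite /D real_normK ?num_real// /sqdist (bigD1 k)//= lerDl.
  by apply: sumr_ge0 => j _; rewrite sqr_ge0.
have cardQ : \sum_(y : grid Q) (kappa / 2) = (Q ^ n)%:R * (kappa / 2).
  by rewrite sumr_const card_ffun !card_ord mulr_natl.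
apply: (le_trans (ler_sum _ (fun y _ => DE y))).
rewrite big_split/= cardQ -mulr_sumr.
have H : \sum_(y : grid Q) sqdist (gradient f) C h (gridpt a h (start y w)) <=
    (Q ^ n)%:R * 4 ^+ n * kappa ^+ 2.
  apply: le_trans (sum_shifted_grid a NQ r_gt0 _ wQ) _.
    by move=> *; exact: sqdist_ge0.
  have -> : (2 ^+ n) ^+ N = (Q ^ n)%:R * 4 ^+ n :> R.
    by rewrite exprAC -natrX NQ natrM exprMn mulrC natrX.
  rewrite ler_wpM2l ?mulr_ge0 ?exprn_ge0//; apply: le_trans energy_small.
  exact: (energy_ge (gradient_martingale L_ge0 f_lip) (gradient_bound L_ge0 f_lip)).
apply: (@le_trans _ _ ((Q ^ n)%:R * (kappa / 2) +
    (2 * kappa)^-1 * ((Q ^ n)%:R * 4 ^+ n * kappa ^+ 2))).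
  by rewrite lerD2l ler_wpM2l// invr_ge0 mulr_ge0// ltW.
rewrite le_eqVlt; apply/orP; left; apply/eqP; field; by rewrite gt_eqF.
Qed.

(** [grid_path] is summed over the start points and the sums are exchanged: each path point then
    gives a translate of the start block. Path points lie between 0 and [v], so these translations
    also stay within Q. *)
Lemma sum_increment_deviation (Q N : nat) (w v : 'I_n -> int) l :
  (2 ^ N = 4 * Q)%N -> (forall i, `|w i| <= Q%:Z) ->
  (forall i, `|w i + v i| <= Q%:Z) ->
  \sum_(y : grid Q)
    `|f (gridpt a (r / 2 ^+ N) (start y (fun i => w i + v i))) ord0 l -
      f (gridpt a (r / 2 ^+ N) (start y w)) ord0 l -
      r / 2 ^+ N * \sum_i (v i)%:~R * C (i, l)| <=
  (Q ^ n)%:R * \sum_i (2 * L * (r / 2 ^+ N) +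
    r / 2 ^+ N * (`|v i|%N%:R * (kappa * (1 + 4 ^+ n) / 2))).
Proof.
move=> NQ wQ wvQ; set h := r / 2 ^+ N.
have h0 : 0 < h by rewrite divr_gt0// exprn_gt0.
have H (y : grid Q) := @grid_path _ _ _ _ L_ge0 (f_lip l) h (gridpt a h (start y w)) v
  (fun i => C (i, l)) h0.
apply: (@le_trans _ _ (\sum_(y : grid Q) \sum_i (2 * L * h + h *
    \sum_(s < `|v i|%N) `|gradient f (i, l) h
      (gridpt a h (start y (fun j => w j + path_point v i s j))) - C (i, l)|))).
  apply: ler_sum => y _; have := H y; rewrite gridptD.
  rewrite (_ : (fun j => start y w j + v j) = start y (fun i => w i + v i)); last first.
    by apply/funext => i; rewrite /start addrA.
  move=> /le_trans; apply; apply: ler_sum => i _; rewrite lerD2l ler_pM2l//.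
  apply: ler_sum => s _; rewrite gridptD.
  rewrite (_ : (fun j => start y w j + path_point v i s j) =
    start y (fun j => w j + path_point v i s j))//.
  by apply/funext => j; rewrite /start addrA.
rewrite exchange_big/= mulr_sumr; apply: ler_sum => i _.
rewrite big_split/= sumr_const card_ffun !card_ord -mulr_sumr.
rewrite -[_ *+ (Q ^ n)%N]mulr_natl mulrDr lerD2l mulrCA ler_pM2l// exchange_big/=.
apply: (@le_trans _ _ (\sum_(s < `|v i|%N)
    ((Q ^ n)%:R * (kappa * (1 + 4 ^+ n) / 2)))).
  apply: ler_sum => s _; apply: sum_gradient_deviation => // j.
  have := path_point_bounds j (ltn_ord s); have := wQ j; have := wvQ j.
  by move: (path_point v i s j) => p; lia.
by rewrite sum_ord_cst mulrCA.
Qed.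

Context (e : 'I_n -> int) (q : nat).
Hypothesis e_small : forall i, `|e i| <= (2 ^ q)%N%:Z.

(** With this scale the coordinates of [tau *: evec] are at most r / 4, so the segment fits in the
    cube from any point of the start block. *)
Let tau : R := r / 2 ^+ q.+2.
Let evec : vec := \row_i (e i)%:~R.
Let slope_vec : vec := \row_l \sum_i (e i)%:~R * C (i, l).

(** The final 1 absorbs the face-average errors, which a suitable choice of grid makes at most
    [kappa] per unit of scale. *)
Definition deviation_factor : R := n%:R * n%:R * 2 ^+ q * ((1 + 4 ^+ n) / 2) + 1.

Definition length_bound : R :=
  tau * (enorm slope_vec + kappa * deviation_factor).

Lemma exists_le_average (Y : finType) (T : Y -> R) (B : R) : (0 < #|Y|)%N ->
  \sum_y T y <= #|Y|%:R * B -> exists y, T y <= B.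
Proof.
move=> Y0 TB; apply: contrapT => /forallNP TN; move: TB; apply/negP.
have /card_gt0P[y0 _] := Y0.
have BT y : B < T y by rewrite ltNge; apply/negP/TN.
rewrite -ltNge mulr_natl -sumr_const (bigD1 y0)//= [ltRHS](bigD1 y0)//=.
by rewrite ltr_leD// ler_sum// => y _; rewrite ltW.
Qed.

(** Averaged over parallel segments, the increments of [f] deviate little from those of the linear
    map [C]; some segment does no worse than the average. *)
Lemma exists_short_segment N : exists2 b : vec,
  dilate 0 r a b /\ dilate 0 r a (b + tau *: evec) &
  dyadic_length N (fun t => f (b + t *: (tau *: evec))) <= length_bound.
Proof.
(* Each of the 2^N increments consists of 2^p grid steps of [e], whereas the error [2 * L * h]
   occurs once per run; a large p makes it relatively small. *)
have [p pP] : exists p, 2 * L * n%:R * n%:R / 2 ^+ p <= kappa.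
  have /cvgrPdist_lt/(_ _ kappa_gt0)[p _ /(_ p (leqnn p))] :=
    cvg_halving (2 * L * n%:R * n%:R).
  by rewrite sub0r normrN => /ltW /(le_trans (ler_norm _)); exists p.
(* The whole segment moves each index by at most 2^N times 2^p times 2^q, so this Q is the
   admissible shift. *)
pose Q := (2 ^ (N + p + q))%N; pose N' := (N + p + q).+2.
have NQ : (2 ^ N' = 4 * Q)%N by rewrite /N' !expnS /Q; lia.
set h := r / 2 ^+ N'; have h0 : 0 < h by rewrite divr_gt0// exprn_gt0.
have hQ : h * (4 * Q%:R) = r.
  by rewrite -[4]/(4%:R) -natrM -NQ natrX /h divfK// expf_neq0.
pose S := (2 ^ p)%N.
have htau : 2 ^+ N * (h * S%:R) = tau.
  rewrite /tau /h /N' /S !exprS !exprD natrX; field.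
  by rewrite !expf_neq0.
pose w (k : nat) : 'I_n -> int := fun i => (k * S)%N%:Z * e i.
have wQ k i : (k <= 2 ^ N)%N -> `|w k i| <= Q%:Z.
  move=> kN; rewrite /w normrM /Q /S !expnD !PoszM ler_pM//.
  by rewrite ger0_norm// -PoszM lez_nat leq_mul2r kN orbT.
pose v : 'I_n -> int := fun i => S%:Z * e i.
have wS k : w k.+1 = fun i => w k i + v i.
  by apply/funext => i; rewrite /w /v mulSn addnC PoszD mulrDl.
pose pt (y : grid Q) k := gridpt a h (start y (w k)).
pose b y := pt y 0%N.
have ptE y k : pt y k = b y + (k%:R / 2 ^+ N) *: (tau *: evec).
  apply/rowP => i; rewrite !mxE /start /w mul0n mul0r addr0.
  rewrite [in LHS]intrD [in LHS]mulrDr addrA; congr (_ + _).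
  rewrite intrM -pmulrn natrM -htau; field.
  by rewrite expf_neq0.
pose D y k l := f (pt y k.+1) ord0 l - f (pt y k) ord0 l -
  h * \sum_i (v i)%:~R * C (i, l).
pose c := kappa * (1 + 4 ^+ n) / 2.
have c0 : 0 <= c by rewrite !mulr_ge0 ?(ltW kappa_gt0) ?addr_ge0 ?exprn_ge0.
pose B := 2 ^+ N * (n%:R * (n%:R * (2 * L * h + h * (S%:R * 2 ^+ q * c)))).
have [y yB] : exists y : grid Q,
    \sum_(0 <= k < 2 ^ N) \sum_l `|D y k l| <= B.
  apply: exists_le_average.
    by rewrite card_ffun !card_ord expn_gt0 expn_gt0.
  rewrite card_ffun !card_ord exchange_big/=.
  apply: (@le_trans _ _ (\sum_(0 <= k < 2 ^ N) (Q ^ n)%:R *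
      (n%:R * (n%:R * (2 * L * h + h * (S%:R * 2 ^+ q * c)))))); last first.
    by rewrite big_mkord sum_ord_cst natrX /B; rewrite le_eqVlt mulrCA eqxx.
  rewrite !big_nat; apply: ler_sum => k /= kN; rewrite exchange_big/=.
  rewrite [leRHS]mulrCA -[leRHS]sum_ord_cst; apply: ler_sum => l _.
  have H := @sum_increment_deviation Q N' (w k) v l NQ.
  rewrite -wS -/h in H; apply: le_trans (H _ _) _.
  - by move=> i; apply: wQ; exact: ltnW.
  - by move=> i; have := congr1 (fun u => u i) (wS k) => /= <-; exact: wQ.
  rewrite ler_wpM2l// -[leRHS]sum_ord_cst; apply: ler_sum => i _.
  rewrite lerD2l ler_pM2l// ler_wpM2r// natr_absz /v normrM intrM.
  rewrite ger0_norm// -pmulrn ler_wpM2l// (_ : 2 ^+ q = (2 ^ q)%N%:~R :> R).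
    by rewrite ler_int e_small.
  by rewrite -pmulrn natrX.
have in_cube k : (k <= 2 ^ N)%N -> dilate 0 r a (pt y k).
  move=> kN; apply/dilateP => i; rewrite mxE mul0r subr0 add0r mul1r.
  rewrite -[X in _ && (_ <= _ + X)]hQ.
  have /andP[s1 s2] := start_bounds y (wQ k i kN).
  rewrite lerDl lerD2l ler_pM2l// mulr_ge0 ?ler0z ?(ltW h0)//=.
  by move: s2; rewrite -(ler_int R) -pmulrn natrM.
exists (b y).
  split; first exact: in_cube.
  have := in_cube (2 ^ N)%N (leqnn _); rewrite ptE natrX divff ?expf_neq0//.
  by rewrite scale1r.
rewrite /dyadic_length.
apply: (@le_trans _ _ (\sum_(0 <= k < 2 ^ N)
    (h * S%:R * enorm slope_vec + \sum_l `|D y k l|))).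
  apply: ler_sum => k _; rewrite -!ptE.
  have -> : f (pt y k.+1) - f (pt y k) =
      (h * S%:R) *: slope_vec + \row_l D y k l.
    apply/rowP => l; rewrite !mxE /D.
    have -> : \sum_i (v i)%:~R * C (i, l) = S%:R * \sum_i (e i)%:~R * C (i, l).
      by rewrite mulr_sumr; apply: eq_bigr => i _; rewrite intrM -pmulrn mulrA.
    by ring.
  rewrite (le_trans (ler_enormD _ _))// lerD//.
    by rewrite enormZ ger0_norm// mulr_ge0// ltW.
  rewrite (le_trans (enorm_le_sum _))//.
  by apply: ler_sum => l _; rewrite mxE.
rewrite big_split/= big_mkord sum_ord_cst natrX mulrA htau.
rewrite /length_bound mulrDr lerD2l (le_trans yB)//.
rewrite /B /deviation_factor -htau.
have -> : 2 ^+ N * (n%:R * (n%:R * (2 * L * h + h * (S%:R * 2 ^+ q * c)))) =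
  2 ^+ N * (h * S%:R) * (2 * L * n%:R * n%:R / 2 ^+ p +
    kappa * (n%:R * n%:R * 2 ^+ q * ((1 + 4 ^+ n) / 2))).
  rewrite /c /S natrX; field.
  by rewrite expf_neq0.
rewrite htau ler_wpM2l//; first by rewrite divr_ge0 ?exprn_ge0 ?(ltW r_gt0).
by rewrite mulrDr mulr1 addrC lerD2l.
Qed.

Lemma cube_compact : compact (dilate 0 r a).
Proof.
have -> : dilate 0 r a = [set v : vec | forall i,
    `[a ord0 i, a ord0 i + r]%classic (v ord0 i)].
  apply/seteqP; split=> v.
    by move=> /dilateP va i /=; have := va i; rewrite in_itv/= mul0r subr0 add0r mul1r.
  move=> va; apply/dilateP => i; have := va i.
  by rewrite /= in_itv/= mul0r subr0 add0r mul1r.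
apply: (@rV_compact _ _ (fun i => `[a ord0 i, a ord0 i + r]%classic)) => i.
exact: segment_compact.
Qed.

Lemma dyadic_length_lip N (d b b' : vec) (rho : R) : 0 <= rho ->
  (forall i, `|b ord0 i - b' ord0 i| <= rho) ->
  dyadic_length N (fun t => f (b + t *: d)) <=
    dyadic_length N (fun t => f (b' + t *: d)) + 2 ^+ N * (2 * (n%:R * (L * rho))).
Proof.
move=> rho0 bb'; have near t : enorm (f (b + t *: d) - f (b' + t *: d)) <= n%:R * (L * rho).
  apply: enorm_le_sup => l; rewrite !mxE; apply: f_lip => // i.
  by rewrite !mxE opprD addrACA subrr addr0.
set X := 2 * _; have -> : 2 ^+ N * X = \sum_(0 <= k < 2 ^ N) X.
  by rewrite big_mkord sum_ord_cst natrX.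
rewrite -big_split/=; apply: ler_sum => k _.
set t := _ / _; set u := (k%:R / _).
have H1 := ler_enorm_triangle (f (b' + t *: d)) (f (b + t *: d)) (f (b + u *: d)).
have H2 := ler_enorm_triangle (f (b' + u *: d)) (f (b' + t *: d)) (f (b + u *: d)).
have := near t; have := near u; rewrite (enormB (f (b + u *: d))) /X; lra.
Qed.

(** The starting points found for the resolutions N accumulate at some x in the compact cube. As the
    dyadic length grows with the resolution and depends continuously on the starting point, the
    segment from x is short at every resolution. *)
Lemma exists_short_curve : exists2 b : vec,
  dilate 0 r a b /\ dilate 0 r a (b + tau *: evec) &
  (curve_length 0 1 (fun t => f (b + t *: (tau *: evec))) <= length_bound%:E)%E.
Proof.
pose d := tau *: evec.
have /choice[b bP] : forall N, exists b,
    (dilate 0 r a b /\ dilate 0 r a (b + d)) /\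
    dyadic_length N (fun t => f (b + t *: d)) <= length_bound.
  by move=> N; have [b] := exists_short_segment N; exists b.
have [x [xa clx]] : dilate 0 r a `&` cluster (b @ \oo) !=set0.
  apply: cube_compact; exists 0%N => // N _; exact: (bP N).1.1.
have close N (rho : R) : 0 < rho -> exists2 N', (N <= N')%N &
    forall i, `|x ord0 i - b N' ord0 i| <= rho.
  move=> rho0; have [||_ [[N' NN' <-] xN']] := clx [set b N' | N' in [set N' | (N <= N')%N]]
      (ball x rho).
  - by exists N => // N' NN'; exists N'.
  - exact: nbhsx_ballx.
  exists N' => // i; case: xN' => _ /(_ ord0 i) /ltW.
  by [].
exists x.
  split => //; apply/dilateP => i; rewrite mul0r subr0 add0r mul1r.
  apply/andP; split; apply/ler_addgt0Pr => rho rho0.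
    have [N' _ /(_ i)] := close 0%N rho rho0.
    have [[_ /dilateP/(_ i) bN'] _] := bP N'; move: bN'.
    by rewrite !mxE mul0r subr0 ler_norml; lra.
  have [N' _ /(_ i)] := close 0%N rho rho0.
  have [[_ /dilateP/(_ i) bN'] _] := bP N'; move: bN'.
  by rewrite !mxE add0r mul1r ler_norml; lra.
pose Lam := n%:R * (L * enorm d).
apply: (@curve_length_dyadic _ _ _ Lam).
- by rewrite !mulr_ge0 ?enorm_ge0.
- move=> t u; rewrite /Lam -!mulrA; apply: enorm_le_sup => l; rewrite !mxE.
  apply: f_lip; first by rewrite mulr_ge0 ?enorm_ge0.
  move=> i; rewrite !mxE opprD addrACA subrr add0r -mulrBl normrM mulrC.
  by rewrite ler_wpM2r//; have := coord_le_enorm d i; rewrite !mxE.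
move=> N; apply/ler_addgt0Pr => eps eps0.
(* Moving the starting point by [eps / A] changes the length at resolution N by at most [eps]; the
   added 1 keeps [A] positive. *)
pose A : R := 2 ^+ N * (2 * (n%:R * L)) + 1.
have A0 : 0 < A by rewrite ltr_wpDl// !mulr_ge0 ?exprn_ge0.
have [N' NN' xN'] := close N (eps / A) (divr_gt0 eps0 A0).
apply: le_trans (dyadic_length_lip N d (ltW (divr_gt0 eps0 A0)) xN') _.
rewrite lerD//; first exact: le_trans (dyadic_length_le _ NN') (bP N').2.
have -> : 2 ^+ N * (2 * (n%:R * (L * (eps / A)))) = (A - 1) / A * eps.
  by rewrite /A; ring.
rewrite ler_piMl ?(ltW eps0)// ler_pdivrMr// mul1r; lra.
Qed.

Lemma slope_vec_lower_bound (M : R) :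
  (forall b d : vec, dilate 0 r a b -> dilate 0 r a (b + d) ->
    ((M^-1 * enorm d)%:E <= curve_length 0 1 (fun t => f (b + t *: d)%R))%E) ->
  M^-1 * enorm evec <= enorm slope_vec + kappa * deviation_factor.
Proof.
have tau0 : 0 < tau by rewrite divr_gt0// exprn_gt0.
have [b [b1 b2] bl] := exists_short_curve => /(_ _ _ b1 b2) H.
have := le_trans H bl; rewrite lee_fin enormZ (gtr0_norm tau0) /length_bound.
by rewrite mulrCA ler_pM2l.
Qed.

End LowerBound.

(** * From affine approximations to the derivative *)

Section SupNorm.
Context (R : realType) (n : nat).
Local Notation vec := 'rV[R]_n.

Lemma subr_coord (x y : vec) i : (x - y) ord0 i = x ord0 i - y ord0 i.
Proof. by rewrite mxE [(- y) _ _]mxE. Qed.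

Lemma coord_le_norm (x : vec) i : `|x ord0 i| <= `|x|.
Proof.
rewrite [leRHS]/Num.norm/= mx_normrE.
exact: (le_bigmax_cond _ (fun k : 'I_1 * 'I_n => `|x k.1 k.2|) (j := (ord0, i))).
Qed.

Lemma norm_le_coord (x : vec) (rho : R) : 0 <= rho ->
  (forall i, `|x ord0 i| <= rho) -> `|x| <= rho.
Proof.
move=> rho0 xrho; rewrite [leLHS]/Num.norm/= mx_normrE; apply: bigmax_le => //.
by move=> [i j] _ /=; rewrite (ord1 i).
Qed.

Lemma norm_le_enorm (x : vec) : `|x| <= enorm x.
Proof. by apply: norm_le_coord => [|i]; [exact: enorm_ge0|exact: coord_le_enorm]. Qed.

Lemma ball_coord (x y : vec) (rho : R) : 0 < rho ->
  (forall i, `|x ord0 i - y ord0 i| < rho) -> ball x rho y.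
Proof. by move=> rho0 xy; split=> // i j; rewrite (ord1 i); exact: xy. Qed.

Lemma coord_ball (x y : vec) (rho : R) i : ball x rho y ->
  `|x ord0 i - y ord0 i| < rho.
Proof. by case=> _; apply. Qed.

Lemma le_archimedean (u v w : R) :
  (forall p : nat, u <= v + w / p.+1%:R) -> u <= v.
Proof.
move=> H; rewrite leNgt; apply/negP => vu.
have uv0 : 0 < u - v by rewrite subr_gt0.
have [p pP] : exists p : nat, w < (u - v) * p.+1%:R.
  exists (Num.truncn (w / (u - v))).
  by rewrite mulrC -ltr_pdivrMr// truncnS_gt.
by have := H p; rewrite -lerBlDl ler_pdivlMr ?ltr0n// leNgt pP.
Qed.

(** The intervals of centre [u p] and radius [w p] meet pairwise, so the supremum of their left ends
    lies in all of them. *)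
Lemma common_limit (u w : nat -> R) :
  (forall p q, `|u p - u q| <= w p + w q) ->
  exists l : R, forall p, `|u p - l| <= w p.
Proof.
move=> uw; pose A := range (fun p => u p - w p).
have ub q : ubound A (u q + w q).
  by move=> _ [p _ <-]; have := uw p q; rewrite ler_norml => /andP[_]; lra.
have supA : has_sup A by split; [exists (u 0%N - w 0%N), 0%N|exists (u 0%N + w 0%N)].
exists (sup A) => p; rewrite ler_norml.
have : u p - w p <= sup A by apply: ub_le_sup; [exact: supA.2|exists p].
have : sup A <= u p + w p by apply: ge_sup; [exact: supA.1|exact: ub].
lra.
Qed.

End SupNorm.

(** * Affine errors and the differential *)

Section Differentiability.
Context (R : realType) (n : nat).
Local Notation vec := 'rV[R]_n.
Implicit Types (f : vec -> vec) (x d : vec).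

(* The error is measured in the sup norm. *)
Definition affine_error f x (A : 'M[R]_n) (eta : R) : Prop :=
  exists2 rho0 : R, 0 < rho0 & forall (rho : R) d, 0 < rho < rho0 ->
    (forall i, `|d ord0 i| <= rho) ->
    forall l, `|(f (x + d) - f x - d *m A) ord0 l| <= eta * rho.

Lemma mulmx_bound (A : 'M[R]_n) (B : 'M[R]_n) (d : vec) (rho eta : R) l :
  (forall i, `|d ord0 i| <= rho) -> (forall i l, `|A i l - B i l| <= eta) ->
  `|(d *m A - d *m B) ord0 l| <= n%:R * eta * rho.
Proof.
move=> drho AB; rewrite -mulmxBr mxE -mulrA -[leRHS]sum_ord_cst.
rewrite (le_trans (ler_norm_sum _ _ _))//; apply: ler_sum => i _.
by rewrite normrM mulrC ler_pM// !mxE AB.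
Qed.

(** Both approximations are tested on the i-th basis vector, scaled to lie below both radii. *)
Lemma affine_error_unique f x A B eta eta' : 
  affine_error f x A eta -> affine_error f x B eta' ->
  forall i l, `|A i l - B i l| <= eta + eta'.
Proof.
move=> [rA rA0 HA] [rB rB0 HB] i l.
pose rho := Num.min rA rB / 2.
have rho0 : 0 < rho by rewrite divr_gt0// lt_min rA0.
have rhoA : rho < rA.
  have : Num.min rA rB <= rA by rewrite ge_min lexx.
  by rewrite /rho; move: rho0; rewrite /rho; lra.
have rhoB : rho < rB.
  have : Num.min rA rB <= rB by rewrite ge_min lexx orbT.
  by rewrite /rho; move: rho0; rewrite /rho; lra.
pose d : vec := rho *: delta_mx ord0 i.
have drho k : `|d ord0 k| <= rho.
  rewrite !mxE eqxx/=; case: (k == i); rewrite ?mulr1 ?mulr0 ?normr0 ?(ltW rho0)//.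
  by rewrite gtr0_norm.
have dE (X : 'M[R]_n) : (d *m X) ord0 l = rho * X i l.
  by rewrite /d -scalemxAl -rowE !mxE.
have := HA rho d _ drho l; have := HB rho d _ drho l.
rewrite rho0 rhoA rhoB => /(_ isT) H1 /(_ isT) H2.
rewrite -(ler_pM2l rho0) -{1}(gtr0_norm rho0) -normrM mulrBr -!dE.
move: H1 H2; rewrite !subr_coord.
move: (f (x + d) ord0 l) (f x ord0 l) ((d *m A) ord0 l) ((d *m B) ord0 l).
by move=> a b c e; rewrite !ler_norml; lra.
Qed.

(** By uniqueness the [C p] satisfy the hypothesis of [common_limit] entrywise; replacing [C p] by
    the limit multiplies the error by at most 1 + n. *)
Lemma affine_error_limit f x (C : nat -> 'M[R]_n) (c : R) :
  (forall p, affine_error f x (C p) (c / p.+1%:R)) ->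
  exists A : 'M[R]_n, (forall p i l, `|C p i l - A i l| <= c / p.+1%:R) /\
    forall eps : R, 0 < eps -> affine_error f x A eps.
Proof.
move=> HC.
have /choice[D DP] : forall k : 'I_n * 'I_n, exists l : R, forall p,
    `|C p k.1 k.2 - l| <= c / p.+1%:R.
  move=> k; apply: common_limit => p q.
  exact: (affine_error_unique (HC p) (HC q)).
pose A : 'M[R]_n := \matrix_(i, l) D (i, l).
have CA p i l : `|C p i l - A i l| <= c / p.+1%:R by rewrite mxE; exact: DP (i, l) p.
exists A; split => // eps eps0.
have [p pP] : exists p : nat, (1 + n%:R) * c / p.+1%:R <= eps.
  exists (Num.truncn ((1 + n%:R) * c / eps)).
  rewrite ler_pdivrMr ?ltr0n// [leRHS]mulrC -ler_pdivrMr//.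
  exact/ltW/truncnS_gt.
have [rho0 rho00 H] := HC p; exists rho0 => // rho d rhoP drho l.
have /andP[rho1 _] := rhoP.
have -> : f (x + d) - f x - d *m A = (f (x + d) - f x - d *m C p) +
    (d *m C p - d *m A) by rewrite addrA subrK.
rewrite mxE (le_trans (ler_normD _ _))//.
apply: le_trans (lerD (H rho d rhoP drho l) (mulmx_bound l drho (CA p))) _.
rewrite -mulrDl ler_wpM2r ?(ltW rho1)//; apply: le_trans pP.
by rewrite le_eqVlt; apply/orP; left; apply/eqP; ring.
Qed.

Lemma affine_error_near f g x A eps : (\forall y \near x, f y = g y) ->
  affine_error f x A eps -> affine_error g x A eps.
Proof.
move=> /nbhs_ballP[r r0 fg] [rho0 rho00 H].
exists (Num.min rho0 r); first by rewrite lt_min rho00.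
move=> rho d /andP[rho1]; rewrite lt_min => /andP[rho2 rho3] drho l.
have fgd (y : vec) : (forall i, `|x ord0 i - y ord0 i| <= rho) -> f y = g y.
  by move=> xy; apply: fg; apply: ball_coord => // i; rewrite (le_lt_trans (xy i)).
rewrite -!fgd; first by apply: H => //; rewrite rho1.
  by move=> i; rewrite subrr normr0 ltW.
by move=> i; rewrite mxE opprD addrA subrr sub0r normrN.
Qed.

Lemma differentiable_affine_error f x (A : 'M[R]_n) :
  (forall eps : R, 0 < eps -> affine_error f x A eps) ->
  differentiable f x /\ ('d f x : vec -> vec) = mulmxr A.
Proof.
move=> H.
have Acont : continuous (mulmxr A : vec -> vec).
  apply: bounded_linear_continuous; apply/linear_boundedP.
  pose K : R := n%:R * \sum_i \sum_l `|A i l|.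
  have AK i l : `|A i l - (0 : 'M[R]_n) i l| <= \sum_i \sum_l `|A i l|.
    rewrite mxE subr0 (bigD1 i)//= (bigD1 l)//= -addrA lerDl addr_ge0 ?sumr_ge0//.
    by move=> *; rewrite sumr_ge0.
  near=> t => y; apply: (@le_trans _ _ (K * `|y|)); last first.
    by rewrite ler_wpM2r//; near: t; exact: nbhs_pinfty_ge.
  apply: norm_le_coord => [|l].
    by rewrite !mulr_ge0 ?sumr_ge0// => *; rewrite sumr_ge0.
  by have := mulmx_bound l (coord_le_norm y) AK; rewrite mulmx0 subr0.
have expand : f \o shift x = cst (f x) + mulmxr A +o_ (0 : vec) id.
  apply/eqaddoP => eps eps0.
  have [rho0 rho00 Hrho] := H eps eps0.
  suff : \forall d \near (0 : vec),
      `|(f \o shift x - (cst (f x) + mulmxr A)) d| <= eps * `|d| by [].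
  apply/nbhs_norm0P; exists rho0 => //= d drho0.
  have -> : (f \o shift x - (cst (f x) + mulmxr A)) d = f (x + d) - f x - d *m A.
    by rewrite /= !fctE/= opprD addrA (addrC d).
  have [->|d0] := eqVneq d 0.
    by rewrite addr0 subrr mul0mx subr0 !normr0 mulr0.
  have dpos : 0 < `|d| by rewrite normr_gt0.
  apply: norm_le_coord; first by rewrite mulr_ge0 ?(ltW eps0).
  (* The sup norm of [d] itself serves as the scale rho. *)
  apply: Hrho => [|i]; last exact: coord_le_norm.
  by rewrite dpos.
have dE := diff_unique Acont expand.
split=> //; apply/diff_locallyP; rewrite dE; split => //.
Unshelve. all: by end_near. Qed.

End Differentiability.

(** * Maps that distort lengths by a bounded factor *)

Section LengthDistortion.
Context (R : realType) (n : nat).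
Local Notation vec := 'rV[R]_n.
Implicit Types (x y d h v : vec).
Hypothesis n_gt0 : (0 < n)%N.
Context (Omega : set vec) (M : R) (f : vec -> vec).
Hypothesis M_ge1 : 1 <= M.
Hypothesis length_distortion :
  forall (a b : R) (g : R -> vec),
    curve_in Omega a b g -> rectifiable a b g ->
    ((M^-1)%:E * curve_length a b g <= curve_length a b (f \o g))%E /\
    (curve_length a b (f \o g) <= M%:E * curve_length a b g)%E.

(** * Length distortion on a cube inside the domain *)

Section OnCube.
Context (r : R) (c : vec).
Hypothesis r_gt0 : 0 < r.
Hypothesis cube_sub : dilate 0 r c `<=` Omega.

Let M_gt0 : 0 < M. Proof. exact: lt_le_trans ltr01 M_ge1. Qed.

(** The coordinatewise retraction onto the cube. It makes [f \o clamp] Lipschitz on the whole space,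
    as the martingale estimates require, and keeps every segment inside Omega. *)
Definition clamp (x : vec) : vec :=
  \row_i Num.max (c ord0 i) (Num.min (x ord0 i) (c ord0 i + r)).

Lemma clamp_cube x : dilate 0 r c (clamp x).
Proof.
apply/dilateP => i; rewrite mxE mul0r subr0 add0r mul1r le_max lexx/=.
by rewrite ge_max lerDl (ltW r_gt0) ge_min lexx orbT.
Qed.

Lemma clamp_id x : dilate 0 r c x -> clamp x = x.
Proof.
move=> /dilateP xc; apply/rowP => i; rewrite mxE.
have := xc i; rewrite mul0r subr0 add0r mul1r => /andP[x1 x2].
by rewrite min_l// max_r.
Qed.

Lemma clamp_coord x y i :
  `|clamp x ord0 i - clamp y ord0 i| <= `|x ord0 i - y ord0 i|.
Proof.
rewrite !mxE; move: (x ord0 i) (y ord0 i) (c ord0 i) => u v w.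
pose k t := Num.max w (Num.min t (w + r)).
have kP s t : s <= t -> 0 <= k t - k s <= t - s.
  rewrite /k; have := r_gt0.
  case: (leP s (w + r)) => ?; case: (leP t (w + r)) => ?.
  - by case: (leP w s) => ?; case: (leP w t) => ?; lra.
  - by case: (leP w s) => ?; case: (leP w (w + r)) => ?; lra.
  - by case: (leP w (w + r)) => ?; case: (leP w t) => ?; lra.
  - by rewrite subrr; lra.
rewrite -/(k u) -/(k v); case: (leP u v) => [|/ltW] /kP /andP[k0 kuv].
  by rewrite distrC [leRHS]distrC !ger0_norm//; lra.
by rewrite !ger0_norm//; lra.
Qed.

Lemma clamp_enorm x y : enorm (clamp x - clamp y) <= enorm (x - y).
Proof.
rewrite ler_wsqrtr// ler_sum// => i _.
rewrite -real_normK ?num_real// -[leRHS]real_normK ?num_real//.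
by rewrite lerXn2r ?nnegrE// !subr_coord clamp_coord.
Qed.

Let seg (x d : vec) (t : R) : vec := clamp (x + t *: d).

Lemma seg_lip x d t u : enorm (seg x d t - seg x d u) <= enorm d * `|t - u|.
Proof.
rewrite (le_trans (clamp_enorm _ _))// opprD addrACA subrr add0r -scalerBl.
by rewrite enormZ mulrC.
Qed.

Lemma lipschitz_continuous (g : R -> vec) (Lam : R) :
  (forall t u, enorm (g t - g u) <= Lam * `|t - u|) -> continuous g.
Proof.
move=> glip t; apply/(@cvgrPdist_le _ _ _ (nbhs t)) => e e0.
have L0 : 0 < `|Lam| + 1 by rewrite ltr_wpDl.
near=> u; rewrite (le_trans (norm_le_enorm _))// (le_trans (glip _ _))//.
rewrite (@le_trans _ _ ((`|Lam| + 1) * `|t - u|))//.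
  by rewrite ler_wpM2r// (le_trans (ler_norm _))// lerDl.
rewrite mulrC -ler_pdivlMr//; near: u; apply: cvgr_dist_le; last by rewrite divr_gt0.
exact: cvg_id.
Unshelve. all: by end_near. Qed.

Lemma seg_length x d :
  ((M^-1)%:E * curve_length 0 1 (seg x d) <=
     curve_length 0 1 (f \o seg x d))%E /\
  (curve_length 0 1 (f \o seg x d) <= M%:E * (enorm d)%:E)%E.
Proof.
have len := curve_length_lipschitz (seg_lip x d).
have [||lo hi] := @length_distortion 0 1 (seg x d).
- split; [exact: ler01| |by move=> _ [t _ <-]; exact/cube_sub/clamp_cube].
  exact/continuous_subspaceT/(lipschitz_continuous (seg_lip x d)).
- exact: le_lt_trans len (ltry _).
split => //; apply: le_trans hi _.
by rewrite lee_pmul2l ?lte_fin.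
Qed.

(** The distance of the image points is at most the length of the image of the segment, which lies
    in the cube. *)
Lemma lipschitz_cube x y : dilate 0 r c x -> dilate 0 r c y ->
  enorm (f x - f y) <= M * enorm (x - y).
Proof.
move=> xc yc; have [_ hi] := seg_length y (x - y).
have := le_trans (curve_length_ge _ ler01) hi.
rewrite -EFinM lee_fin /= /seg scale1r scale0r addr0 [y + _]addrC subrK.
by rewrite !clamp_id.
Qed.

Let fc := f \o clamp.

Lemma clamped_lipschitz x y : enorm (fc x - fc y) <= M * enorm (x - y).
Proof.
rewrite (le_trans (lipschitz_cube (clamp_cube x) (clamp_cube y)))//.
by rewrite ler_pM2l// clamp_enorm.
Qed.

Let L := M * n%:R.

Let L_ge0 : 0 <= L. Proof. by rewrite mulr_ge0// ltW. Qed.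

Lemma clamped_suplip l : suplip L (fun x => fc x ord0 l).
Proof.
move=> x y rho rho0 xy; rewrite -subr_coord.
rewrite (le_trans (coord_le_enorm _ _))// (le_trans (clamped_lipschitz _ _))//.
rewrite /L -mulrA ler_pM2l//; apply: enorm_le_sup => i.
by rewrite subr_coord.
Qed.

Lemma clamped_lower x d : dilate 0 r c x -> dilate 0 r c (x + d) ->
  ((M^-1 * enorm d)%:E <= curve_length 0 1 (fun t => fc (x + t *: d)))%E.
Proof.
move=> xc xdc; have [lo _] := seg_length x d; apply: le_trans lo.
rewrite EFinM lee_pmul2l ?lte_fin ?invr_gt0//.
apply: le_trans (curve_length_ge _ ler01); rewrite lee_fin /seg.
by rewrite scale1r scale0r addr0 !clamp_id// addrC addKr.
Qed.

Lemma subcube_cover j (r' : R) (c' x : vec) : 0 < r' -> dilate 0 r' c' x ->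
  exists2 a, subcube j r' c' a & dilate 0 (r' / 2 ^+ j) a x.
Proof.
elim: j r' c' => [|j IH] r' c' r'0 xc; first by exists c'; rewrite ?divr1.
pose s : {ffun 'I_n -> bool} := [ffun i => c' ord0 i + r' / 2 < x ord0 i].
have xs : dilate 0 (r' / 2) (c' + (r' / 2) *: bitvec R s) x.
  apply/dilateP => i; have /dilateP/(_ i) := xc.
  rewrite addZmxE mxE ffunE !mul0r !subr0 !add0r !mul1r.
  by case: (ltP (c' ord0 i + r' / 2)) => ? /andP[? ?];
    rewrite ?mulr1 ?mulr0 ?addr0; lra.
have [|a ja xa] := IH _ _ _ xs; first by rewrite divr_gt0.
by exists a; [exists s|rewrite -half_pow].
Qed.

Lemma dilate_le K K' (r' : R) (a : vec) : 0 < r' -> K <= K' ->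
  dilate K r' a `<=` dilate K' r' a.
Proof.
move=> r'0 KK' x /dilateP xa; apply/dilateP => i; have := xa i.
by move=> /andP[x1 x2]; apply/andP; split; nra.
Qed.

Definition good_point (g : vec -> vec) x :=
  differentiable g x /\ forall h : vec,
    M^-1 * enorm h <= enorm ('d g x h) /\ enorm ('d g x h) <= M * enorm h.

Definition matrix_of (C : 'I_n * 'I_n -> R) : 'M[R]_n := \matrix_(i, l) C (i, l).

Definition intvec (e : 'I_n -> int) : vec := \row_i (e i)%:~R.

(** The constant of [affine_approximation], whose error is then [slack / N] times rho. *)
Definition slack : R := 2 * (n%:R * (3 * L + 2) + 2 * L).

(** The same [C] serves twice: for the affine approximation with N = p + 1, and for the lower bound
    on a single subcube of generation [j0] containing x, with [kappa] = 1 / (p + 3). *)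
Lemma nontangential_affine (p : nat) x :
  (forall i, c ord0 i < x ord0 i < c ord0 i + r) ->
  nontangential (gradient fc) (p.+1%:R + 1) ((p.+1%:R + 2)^-1 ^+ 2) r c x ->
  exists C : 'M[R]_n, affine_error fc x C (slack / p.+1%:R) /\
    forall (e : 'I_n -> int) (q : nat), (forall i, `|e i| <= (2 ^ q)%N%:Z) ->
      M^-1 * enorm (intvec e) <=
        enorm (intvec e *m C) + deviation_factor R n q / p.+1%:R.
Proof.
move=> xc [C [j0 Cj0]]; exists (matrix_of C); split.
  have N0 : 0 < p.+1%:R :> R by rewrite ltr0n.
  have [rho0 rho00 H] := @affine_approximation _ _ L fc L_ge0 clamped_suplip
    p.+1%:R r c x C j0 N0 r_gt0 xc Cj0.
  exists rho0 => // rho d rhoP drho l; rewrite !subr_coord mxE.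
  under eq_bigr do rewrite mxE.
  apply: le_trans (H rho d l rhoP drho) _.
  by rewrite /slack le_eqVlt; apply/orP; left; apply/eqP; ring.
move=> e q eq.
have x0c : dilate 0 r c x.
  by apply/dilateP => i; rewrite mul0r subr0 add0r mul1r; have := xc i; lra.
have [a ja xa] := subcube_cover j0 r_gt0 x0c.
have h0 : 0 < r / 2 ^+ j0 by rewrite divr_gt0// exprn_gt0.
have energy_a := Cj0 j0 a (leqnn _) ja (dilate_le h0 (ler_wpDr ler01 (ler0n _ _)) xa).
have kappa0 : 0 < (p.+1%:R + 2)^-1 :> R by rewrite invr_gt0 ltr_wpDl.
have lower := @slope_vec_lower_bound _ _ L fc L_ge0 clamped_suplip
  (r / 2 ^+ j0) a C _ h0 kappa0 energy_a e q eq M.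
have -> : intvec e *m matrix_of C = \row_l \sum_i (e i)%:~R * C (i, l).
  by apply/rowP => l; rewrite !mxE; apply: eq_bigr => i _; rewrite !mxE.
apply: le_trans (lower _) _.
  move=> b d b1 b2; apply: clamped_lower.
    exact: (dilate_subcube (lexx 0) r_gt0 ja).
  exact: (dilate_subcube (lexx 0) r_gt0 ja).
rewrite lerD2l mulrC ler_wpM2l//.
  rewrite /deviation_factor addr_ge0// !mulr_ge0 ?exprn_ge0// addr_ge0//.
by rewrite lef_pV2 ?posrE// ?ltr0n ?ltr_wpDl// lerDl.
Qed.

Lemma nontangential_good x :
  (forall i, c ord0 i < x ord0 i < c ord0 i + r) ->
  (forall p : nat, nontangential (gradient fc) (p.+1%:R + 1)
     ((p.+1%:R + 2)^-1 ^+ 2) r c x) ->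
  good_point f x.
Proof.
move=> xc nt.
have /choice[C CP] := fun p => nontangential_affine xc (nt p).
have [A [CA Aeps]] := affine_error_limit (fun p => (CP p).1).
(* As x is interior to the cube, [f] and its clamped version agree near x. *)
have fcA : forall eps : R, 0 < eps -> affine_error f x A eps.
  move=> eps eps0; apply: affine_error_near (Aeps eps eps0).
  have [m m0 xm] : exists2 m : R, 0 < m & forall i,
      m <= Num.min (x ord0 i - c ord0 i) (c ord0 i + r - x ord0 i).
    by apply: fin_lower_bound => i; rewrite lt_min !subr_gt0.
  apply/nbhs_ballP; exists m => // y xy; rewrite /fc /= clamp_id//.
  apply/dilateP => i; rewrite mul0r subr0 add0r mul1r.
  have := coord_ball i xy; have := xm i; rewrite le_min ltr_norml; lra.
have [df dE] := differentiable_affine_error fcA.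
split => // h; rewrite dE /=.
have upper (v : vec) : enorm (v *m A) <= M * enorm v.
  have [->|v0] := eqVneq v 0; first by rewrite mul0mx enorm0 mulr0.
  have vpos : 0 < enorm v.
    by rewrite (lt_le_trans _ (norm_le_enorm v))// normr_gt0.
  apply: (@le_archimedean _ _ _ (n%:R * enorm v)) => p.
  have e0 : 0 < p.+1%:R^-1 :> R by rewrite invr_gt0 ltr0n.
  have [rho0 rho00 H] := Aeps _ e0.
  pose rho := rho0 / 2; have rhoP : 0 < rho < rho0 by rewrite /rho; lra.
  have /andP[rhopos _] := rhoP.
  (* The Lipschitz bound is tested on [t *: v], of Euclidean norm rho; after division by t the
     affine error is at most n [enorm v] / (p + 1). *)
  pose t := rho / enorm v; have t0 : 0 < t by rewrite divr_gt0.
  have tv : t * enorm v = rho by rewrite /t divfK// gt_eqF.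
  have tvi i : `|(t *: v) ord0 i| <= rho.
    by rewrite mxE normrM (gtr0_norm t0) -tv ler_pM2l// coord_le_enorm.
  have err := enorm_le_sup (H rho _ rhoP tvi).
  rewrite -(ler_pM2l t0) -{1}(gtr0_norm t0) -enormZ scalemxAl.
  rewrite -(subKr (fc (x + t *: v) - fc x) ((t *: v) *m A)).
  rewrite (le_trans (ler_enormD _ _))// enormN.
  apply: le_trans (lerD (clamped_lipschitz _ _) err) _.
  rewrite [x + _]addrC addrK enormZ (gtr0_norm t0) mulrDr mulrCA lerD2l -tv.
  by rewrite le_eqVlt; apply/orP; left; apply/eqP; ring.
split; last exact: upper.
(* The bounds for [C p] pass to [A] as p grows, since for a fixed [e] both [q] and the coordinate
   bound [E] are fixed. *)
have lower_int (e : 'I_n -> int) :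
    M^-1 * enorm (intvec e) <= enorm (intvec e *m A).
  set v := intvec e.
  have [q qP] : exists q : nat, forall i, `|e i| <= (2 ^ q)%N%:Z.
    exists (\max_i absz (e i))%N => i.
    rewrite -abszE lez_nat (leq_trans _ (ltnW (ltn_expl _ _)))//.
    exact: (leq_bigmax i).
  pose E : R := \sum_i `|v ord0 i|.
  apply: (@le_archimedean _ _ _ (n%:R * (n%:R * slack * E) +
    deviation_factor R n q)) => p.
  have := (CP p).2 e q qP => /le_trans; apply.
  rewrite [X in _ <= _ + X]mulrDl addrA lerD2r -/v.
  rewrite -(subrK (v *m A) (v *m C p)) addrC (le_trans (ler_enormD _ _))//.
  rewrite lerD2r.
  have -> : n%:R * (n%:R * slack * E) / p.+1%:R =
    n%:R * (n%:R * (slack / p.+1%:R) * E) by ring.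
  apply: enorm_le_sup => l; apply: mulmx_bound => [i|i l']; last exact: CA.
  by rewrite /E (bigD1 i)//= lerDl sumr_ge0.
apply: (@le_archimedean _ _ _ (M^-1 * n%:R + M * n%:R)) => p.
(* [T *: h] is rounded to an integer vector; this costs a constant independent of [T], which
   disappears after division by [T] as p grows. *)
pose T : R := p.+1%:R; have T0 : 0 < T by rewrite ltr0n.
pose v := intvec (fun i => Num.floor (T * h ord0 i)).
have vT : enorm (v - T *: h) <= n%:R.
  rewrite -[leRHS]mulr1; apply: enorm_le_sup => i.
  rewrite subr_coord !mxE; have := floor_itv (T * h ord0 i).
  by rewrite intrD ler_norml; lra.
rewrite -(ler_pM2l T0) mulrDr (mulrC _ (_ / _)) divfK ?gt_eqF//.
rewrite mulrCA -{1 2}(gtr0_norm T0) -!enormZ scalemxAl.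
have hv : enorm (T *: h) <= enorm v + n%:R.
  rewrite -{1}(subKr v (T *: h)) (le_trans (ler_enormD _ _))// enormN.
  by rewrite lerD2l.
have vh : enorm (v *m A) <= enorm ((T *: h) *m A) + M * n%:R.
  rewrite -{1}(subrK (T *: h) v) mulmxDl addrC (le_trans (ler_enormD _ _))//.
  by rewrite lerD2l (le_trans (upper _))// ler_pM2l.
apply: (@le_trans _ _ (M^-1 * (enorm v + n%:R))).
  by rewrite ler_pM2l// invr_gt0.
rewrite mulrDr; have := lower_int (fun i => Num.floor (T * h ord0 i)).
rewrite -/v /=; lra.
Qed.

(** Off the faces of the cube, a point that is not good violates [nontangential] for some p; this
    leaves finitely many hyperplane pieces and countably many null sets. *)
Lemma cube_ae_good :
  lebesgue_outer [set x | dilate 0 r c x /\ ~ good_point f x] = 0%E.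
Proof.
pose face (p : 'I_n * bool) := [set x : vec | dilate 0 r c x /\
  x ord0 p.1 = c ord0 p.1 + p.2%:R * r].
pose bad (p : nat) := [set x | dilate 0 r c x /\
  ~ nontangential (gradient fc) (p.+1%:R + 1) ((p.+1%:R + 2)^-1 ^+ 2) r c x].
apply: (@lebesgue_outer_null_subset _ _ _ ((\bigcup_p face p) `|` (\bigcup_p bad p))).
  move=> x [xc xbad]; apply: contrapT => /not_orP[nface nbad]; apply: xbad.
  apply: nontangential_good => [i|p]; last first.
    by apply: contrapT => np; apply: nbad; exists p.
  have /dilateP/(_ i) := xc; rewrite mul0r subr0 add0r mul1r => /andP[x1 x2].
  rewrite !lt_neqAle x1 x2 !andbT; apply/andP; split; apply/eqP => E; apply: nface.
    by exists (i, false) => //; split => //=; rewrite mul0r addr0.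
  by exists (i, true) => //; split => //=; rewrite mul1r.
apply/eqP; rewrite eq_le lebesgue_outer_ge0 andbT.
rewrite (le_trans (lebesgue_outerU n_gt0 _ _))//.
rewrite (lebesgue_outer_null_bigcup (A := bad)) ?adde0; last first.
  move=> p; apply: (nontangential_ae n_gt0
    (gradient_martingale L_ge0 clamped_suplip)
    (gradient_bound L_ge0 clamped_suplip)) => //.
rewrite (le_trans (lebesgue_outer_bigcup_fin n_gt0 _))// big1// => p _.
exact/hyperplane_null/ltW.
Qed.

End OnCube.

Lemma open_cube x : open Omega -> Omega x -> exists2 e : R, 0 < e &
  forall y, (forall i, `|x ord0 i - y ord0 i| < e) -> Omega y.
Proof.
move=> Oopen Ox; have /nbhs_ballP[e /= e0 xe] := open_nbhs_nbhs (conj Oopen Ox).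
by exists e => // y xy; apply: xe; exact: ball_coord.
Qed.

Lemma locally_lipschitz_distortion : open Omega -> locally_lipschitz Omega f.
Proof.
move=> Oopen x Ox; have [e e0 xe] := open_cube Oopen Ox.
pose c : vec := x - const_mx (e / 2).
have sub : dilate 0 e c `<=` Omega.
  move=> y /dilateP yc; apply: xe => i; have := yc i.
  by rewrite !mxE ltr_norml; lra.
have yc y : ball x (e / 2) y -> dilate 0 e c y.
  move=> xy; apply/dilateP => i; rewrite !mxE.
  by have := coord_ball i xy; rewrite ltr_norml; lra.
exists (ball x (e / 2)), M; split; first by apply: nbhsx_ballx; rewrite divr_gt0.
by move=> y z [xy _] [xz _]; apply: (lipschitz_cube e0 sub); exact: yc.
Qed.

(** Every point of the open set Omega lies in a closed lattice cube of side 2^-k contained in Omega.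
    There are countably many such cubes, enumerated here by [unpickle]. *)
Lemma ae_good_distortion : open Omega -> ae_on Omega (good_point f).
Proof.
move=> Oopen.
pose cube (k : nat * {ffun 'I_n -> int}) : set vec :=
  dilate 0 (1 / 2 ^+ k.1) (gridpt 0 (1 / 2 ^+ k.1) k.2).
pose bad (m : nat) : set vec :=
  if unpickle m is Some k then
    [set x | [/\ cube k `<=` Omega, cube k x & ~ good_point f x]] else set0.
apply: (@lebesgue_outer_null_subset _ _ _ (\bigcup_m bad m)); last first.
  apply: lebesgue_outer_null_bigcup => m; rewrite /bad.
  case: unpickle => [k|]; last exact: lebesgue_outer0.
  have [kO|kO] := pselect (cube k `<=` Omega); last first.
    by apply: lebesgue_outer_null_subset (lebesgue_outer0 _ n_gt0) => x [].
  have k0 : 0 < 1 / 2 ^+ k.1 :> R by rewrite divr_gt0// exprn_gt0.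
  by apply: lebesgue_outer_null_subset (cube_ae_good k0 kO) => x [].
move=> x [Ox xbad]; have [e e0 xe] := open_cube Oopen Ox.
have [k ke] : exists k : nat, 1 / 2 ^+ k < e.
  have /cvgrPdist_lt/(_ _ e0)[k _ /(_ k (leqnn k))] := @cvg_halving R 1.
  by rewrite sub0r normrN => /(le_lt_trans (ler_norm _)); exists k.
set h : R := 1 / 2 ^+ k in ke; have h0 : 0 < h by rewrite divr_gt0// exprn_gt0.
pose z : {ffun 'I_n -> int} := [ffun i => Num.floor (x ord0 i / h)].
have zP i : h * (z i)%:~R <= x ord0 i <= h * (z i)%:~R + h.
  rewrite ffunE; have /andP[z1 z2] := floor_itv (x ord0 i / h).
  move: z1 z2; rewrite ler_pdivlMr// ltr_pdivrMr// intrD mulrDl mul1r.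
  by rewrite !(mulrC _ h) => -> /ltW ->.
exists (pickle (k, z)) => //; rewrite /bad pickleK; split => //.
  move=> y /dilateP yz; apply: xe => i; have := yz i; have := zP i.
  rewrite !mxE /= -/h ltr_norml; lra.
by apply/dilateP => i; rewrite !mxE /= -/h; have := zP i; lra.
Qed.

End LengthDistortion.

Theorem theorem1p1 (R : realType) (n : nat) (hn : (1 <= n)%N)
    (Omega : set 'rV[R]_n) (hOmega : domain Omega)
    (M : R) (hM : 1 <= M)
    (f : 'rV[R]_n -> 'rV[R]_n) (hf : {within Omega, continuous f})
    (hlen : forall (a b : R) (g : R -> 'rV[R]_n),
       curve_in Omega a b g -> rectifiable a b g ->
       ((M^-1)%:E * curve_length a b g <= curve_length a b (f \o g))%E /\
       (curve_length a b (f \o g) <= M%:E * curve_length a b g)%E) :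
  locally_lipschitz Omega f /\
  ae_on Omega (fun x =>
    differentiable f x /\
    forall h : 'rV[R]_n,
      M^-1 * enorm h <= enorm ('d f x h) /\
      enorm ('d f x h) <= M * enorm h).
Proof.
have [_ Oopen _] := hOmega; split.
  exact: locally_lipschitz_distortion hM hlen Oopen.
exact (ae_good_distortion hn hM hlen Oopen).
Qed.
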